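(* Let $a\in L^1(0,\infty)$, $a\not\equiv0$, be compactly supported. Consider, for real-valued $q\in L^1[0,1]$, the problem $$u_t=u_{xx}-q(x)u,\quad 0\le x\le1,\ t>0;\qquad u(x,0)=0;\qquad u(0,t)=0,\quad u(1,t)=a(t),$$ assumed to be solvable, and let $b(t):=u_x(1,t)$, $t>0$. The inverse problem of finding $q$ from $\{a(t),b(t):t>0\}$ has at most one solution: if $q_1,q_2\in L^1[0,1]$ are real-valued and, with the same $a$, produce the same $b(t)$ for all $t>0$, then $q_1=q_2$ almost everywhere.
   Context: $u$ denotes the solution of the initial-boundary value problem with potential $q$. It is assumed that this problem is solvable and that the solution and the data $a,b$ can be Laplace transformed in $t$. *)

(* Defs.v *)
From HB Require Import structures.
From mathcomp Require Import all_boot all_order all_algebra.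
From mathcomp Require Import all_classical all_reals all_analysis.
Import Order.TTheory GRing.Theory Num.Theory.
Import numFieldNormedType.Exports.

Set Implicit Arguments.
Unset Strict Implicit.
Unset Printing Implicit Defensive.

Local Open Scope classical_set_scope.
Local Open Scope ring_scope.

Section HeatProblem.
Context {R : realType}.
Local Notation mu := (@lebesgue_measure R).
Implicit Types (a b q f g : R -> R) (u : R -> R -> R).

(* [f] is absolutely continuous on the segment [c, d], with derivative [g]
   in L^1(c, d): [f] is an indefinite Lebesgue integral of [g]. *)
Definition ac_deriv (c d : R) f g : Prop :=
  mu.-integrable `[c, d] (EFin \o g) /\
  (forall x, x \in `[c, d] -> f x = f c + \int[mu]_(y in `[c, x]) g y).

Definition compactly_supported f : Prop :=
  exists T : R, {ae mu, forall t, T < t -> f t = 0}.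

(* Since [q] is only in L^1, the equation can only hold almost everywhere; a
   solution is a strong one: for almost every t, u(., t) is C^1 on [0, 1] with
   absolutely continuous u_x(., t), and t |-> u(., t) is locally absolutely
   continuous from (0, +oo) to L^1(0, 1). The initial value is attained in
   L^1(0, 1): pointwise attainment would admit nonzero solutions with zero data
   that are singular at a corner, such as x t^(-3/2) exp(- x^2 / (4 t)) near
   (0, 0). The boundary values hold almost everywhere because [a] is only in
   L^1. *)
Definition heat_solution q a u : Prop :=
  exists ut ux uxx : R -> R -> R,
  [/\ (forall s T : R, 0 < s -> s < T ->
         (mu \x mu)%E.-integrable (`[0, 1] `*` `[s, T])
           (fun z : R * R => (ut z.1 z.2)%:E)),
      {ae mu, forall x, x \in `[0, 1] ->
         forall s T : R, 0 < s -> s < T -> ac_deriv s T (u x) (ut x)},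
      {ae mu, forall t, 0 < t ->
         [/\ ac_deriv 0 1 (u ^~ t) (ux ^~ t),
             ac_deriv 0 1 (ux ^~ t) (uxx ^~ t)
           & {ae mu, forall x, x \in `[0, 1] ->
                ut x t = uxx x t - q x * u x t}]},
      (forall x, x \in `[0, 1] -> u x 0 = 0) /\
      ((\int[mu]_(x in `[0%R, 1%R]) (`|u x t - u x 0|)%:E)%E
         @[t --> (0 : R)^'+] --> 0%E)
    & {ae mu, forall t, 0 < t -> u 0 t = 0 /\ u 1 t = a t}].

(* b(t) = u_x(1, t), the one-sided derivative at the endpoint of [0, 1]. *)
Definition boundary_flux u b : Prop :=
  {ae mu, forall t, 0 < t ->
     ((u x t - u 1 t) / (x - 1)) @[x --> (1 : R)^'-] --> b t}.

Definition laplace_transformable f : Prop :=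
  exists sigma : R,
    mu.-integrable `]0, +oo[ (fun t => (expR (- (sigma * t)) * f t)%:E).

(* Absolute convergence of the Laplace integral of t |-> u(., t), viewed as a
   function with values in L^1(0, 1). *)
Definition laplace_transformable_in_t u : Prop :=
  exists sigma : R,
    (mu \x mu)%E.-integrable (`[0, 1] `*` `]0, +oo[)
      (fun z : R * R => (expR (- (sigma * z.2)) * u z.1 z.2)%:E).

End HeatProblem.

(* Main.v *)
Require Import Defs.
From HB Require Import structures.
From mathcomp Require Import all_boot all_order all_algebra.
From mathcomp Require Import all_classical all_reals all_analysis.
From mathcomp Require Import measurable_realfun ring lra.
Import Order.TTheory GRing.Theory Num.Theory.
Import numFieldNormedType.Exports.

Local Open Scope classical_set_scope.
Local Open Scope ring_scope.

Set Implicit Arguments.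
Unset Strict Implicit.
Unset Printing Implicit Defensive.

(** Let A and B be the Laplace transforms of a and b. Testing the heat equation
    against a solution f of f'' = (q + l) f with f 0 = 0 gives
    B(l) f(1) = A(l) f'(1) for both potentials. The transform of a nonzero
    compactly supported function vanishes on no interval, so for a dense set of
    large l the Dirichlet solutions for q1 and q2 have the same logarithmic
    derivative at 1. With l = (z / 2)^2 and growing solutions e^(z x / 2) v_i(x, z),
    v_i = 1 + O(1 / z), the Wronskian identity yields
      int_0^1 p(x) e^(z x) v_1 v_2 dx = O(z),   p = q2 - q1,
    although the integrand is exponentially large.

    Finite sums of the exponentials e^(z (x - s)) approximate the indicator of
    x > s. Summing the previous integrals in this way gives 0 in the limit, while
    the Volterra equations for the v_i show that replacing v_1 v_2 by 1 costs a
    function of x - s with a uniform Lipschitz bound. Comparing s and s' > s,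
      |int_s^s' p| <= C (s' - s) int_s^1 |p|,
    so |p(x)| <= C int_x^1 |p| almost everywhere by Lebesgue differentiation, and
    p = 0 follows as in Gronwall's lemma, starting from the endpoint 1. *)

(** * Real-valued Lebesgue integrals and dominated convergence *)

Section RealIntegral.
Context {R : realType}.
Local Notation mu := (@lebesgue_measure R).
Local Notation intg D f := (mu.-integrable D (EFin \o f)).
Implicit Types (f g h k : R -> R) (D : set (measurableTypeR R)).

(** A single integral against [e^(z x)] sees [p] only near [x = 1]. Locating an interior point [s]
    needs cancellation between many exponentials, with binomial coefficients so large that
    [v_i - 1 = O(1 / z)] is useless term by term. The estimates therefore concern whole sums
    [sum_j c_j e^(z_j y)], with [y] independent of [x]. Multiplying the [j]-th term by the Volterra
    kernel amounts to integrating the sum over a window [[y - d, y]], so a bound [e^(gam y)] on the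
    sum survives with a gain [1 / gam] and no trace of the coefficients. The sums expand
    [1 - (1 - r^n)^(M^n)], the polynomial of the elementary proof of the Stone-Weierstrass theorem.
    With [r] an exponential in [x - s] it yields the step at [s]; with [r] proportional to time it
    shows that vanishing moments force a function to vanish, which is behind the density of the
    admissible [l]. Only real [l] occur throughout, so no analytic continuation is involved. *)

Lemma intg_measurable D f : intg D f -> measurable_fun D f.
Proof. by move=> /integrableP[/measurable_EFinP]. Qed.

Lemma intgD D f g : measurable D -> intg D f -> intg D g ->
  intg D (fun x => f x + g x).
Proof. by move=> mD If Ig; exact: (integrableD mD If Ig). Qed.

Lemma intgB D f g : measurable D -> intg D f -> intg D g ->
  intg D (fun x => f x - g x).
Proof. by move=> mD If Ig; exact: (integrableB mD If Ig). Qed.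

Lemma intgZl D (r : R) f : measurable D -> intg D f -> intg D (fun x => r * f x).
Proof. by move=> mD If; exact: (integrableZl mD r If). Qed.

Lemma intgZr D (r : R) f : measurable D -> intg D f -> intg D (fun x => f x * r).
Proof. by move=> mD If; exact: (integrableZr mD r If). Qed.

Lemma intg_ext D f g : measurable D -> (forall x, D x -> f x = g x) ->
  intg D f -> intg D g.
Proof.
move=> mD fg; apply: eq_integrable => // x /[!inE] Dx /=.
by rewrite fg.
Qed.

Lemma intg_sum D (I : Type) (s : seq I) (F : I -> R -> R) : measurable D ->
  (forall i, intg D (F i)) -> intg D (fun x => \sum_(i <- s) F i x).
Proof.
move=> mD IF; elim: s => [|i s IHs].
  apply: (@intg_ext _ (cst 0)) => //; last exact: integrable0.
  by move=> x _; rewrite big_nil.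
apply: (@intg_ext _ (fun x => F i x + \sum_(i <- s) F i x)) => //; last exact: intgD.
by move=> x _; rewrite big_cons.
Qed.

Lemma Rint_sum D (I : Type) (s : seq I) (F : I -> R -> R) : measurable D ->
  (forall i, intg D (F i)) ->
  \int[mu]_(x in D) (\sum_(i <- s) F i x) = \sum_(i <- s) \int[mu]_(x in D) F i x.
Proof.
move=> mD IF; elim: s => [|i s IHs].
  rewrite big_nil (_ : (fun x => _) = cst 0); last first.
    by apply/funext => x; rewrite big_nil.
  by rewrite Rintegral_cst// mul0r.
rewrite big_cons -IHs -RintegralD//; last exact: intg_sum.
by apply: eq_Rintegral => x _; rewrite big_cons.
Qed.

Lemma bounded_onP D f (M : R) : (forall x, D x -> `|f x| <= M) ->
  [bounded f x | x in D].
Proof.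
move=> fM; exists M; split; first exact: num_real.
by move=> x Mx t Dt; exact: le_trans (fM _ Dt) (ltW Mx).
Qed.

Lemma intgMr D f g (M : R) : measurable D -> intg D f -> measurable_fun D g ->
  (forall x, D x -> `|g x| <= M) -> intg D (fun x => f x * g x).
Proof.
move=> mD If mg gM; apply: (integrableMl mD If mg).
exact: bounded_onP gM.
Qed.

Lemma intgMl D f g (M : R) : measurable D -> intg D f -> measurable_fun D g ->
  (forall x, D x -> `|g x| <= M) -> intg D (fun x => g x * f x).
Proof.
move=> mD If mg gM; apply: (integrableMr mD mg _ If).
exact: bounded_onP gM.
Qed.

Lemma intg_le D f g : measurable D -> measurable_fun D f -> intg D g ->
  (forall x, D x -> `|f x| <= g x) -> intg D f.
Proof.
move=> mD mf Ig fg; apply: (le_integrable mD _ _ Ig); first exact/measurable_EFinP.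
by move=> x Dx /=; rewrite lee_fin (le_trans (fg _ Dx))// ler_norm.
Qed.

Lemma norm_Rint_le D f g : measurable D -> intg D f -> intg D g ->
  (forall x, D x -> `|f x| <= g x) ->
  `|\int[mu]_(x in D) f x| <= \int[mu]_(x in D) g x.
Proof.
move=> mD If Ig fg; apply: le_trans (le_normr_Rintegral mD If) _.
by apply: le_Rintegral => //; exact: integrable_norm.
Qed.

Lemma intgS D E f : measurable D -> measurable E -> D `<=` E ->
  intg E f -> intg D f.
Proof. by move=> mD mE DE; exact: integrableS. Qed.

Lemma Rint_cvg D (F : nat -> R -> R) f g : measurable D ->
  (forall n, measurable_fun D (F n)) -> intg D g ->
  (forall x, D x -> F n x @[n --> \oo] --> f x) ->
  (forall n x, D x -> `|F n x| <= g x) ->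
  intg D f /\ \int[mu]_(x in D) F n x @[n --> \oo] --> \int[mu]_(x in D) f x.
Proof.
move=> mD mF Ig Ff Fg.
have mf : measurable_fun D f by exact: measurable_fun_cvg Ff.
have IF n : intg D (F n).
  by apply: (intg_le mD (mF n) Ig) => x Dx; exact: Fg.
have [| | |//| |If _ cv] := @dominated_convergence _ _ _ mu D mD
    (fun n => EFin \o F n) (EFin \o f) (EFin \o g).
- by move=> n; exact/measurable_EFinP.
- exact/measurable_EFinP.
- by apply: aeW => x Dx; apply/cvg_EFin; [exact: nearW|exact: Ff].
- by apply: aeW => x n Dx; rewrite /= lee_fin Fg.
split=> //; apply: fine_cvg.
by rewrite /Rintegral fineK//; exact: integrable_fin_num.
Qed.

Lemma ae_eq_Rint D f g : measurable D -> measurable_fun D f ->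
  measurable_fun D g -> {ae mu, forall x, D x -> f x = g x} ->
  \int[mu]_(x in D) f x = \int[mu]_(x in D) g x.
Proof.
move=> mD mf mg fg; rewrite /Rintegral; congr fine.
apply: ae_eq_integral => //; [exact/measurable_EFinP..|].
by apply: filterS fg => x fgx Dx; rewrite /= fgx.
Qed.

Lemma Rint_le_subset D E f : measurable D -> measurable E -> D `<=` E ->
  intg E f -> (forall x, E x -> 0 <= f x) ->
  \int[mu]_(x in D) f x <= \int[mu]_(x in E) f x.
Proof.
move=> mD mE DE If f0; have ID := intgS mD mE DE If.
apply: fine_le; [exact: integrable_fin_num..|].
apply: ge0_subset_integral => //.
by case/integrableP : If.
Qed.

Lemma itv_cont_measurable (a b : R) f : {within `[a, b], continuous f} ->
  measurable_fun `[a, b] f.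
Proof. by move=> cf; exact: subspace_continuous_measurable_fun. Qed.

Lemma itv_cont_bounded (a b : R) f : {within `[a, b], continuous f} ->
  exists2 M, 0 <= M & forall x, x \in `[a, b] -> `|f x| <= M.
Proof.
move=> cf; have [ab|ba] := leP a b; last first.
  exists 0 => // x; rewrite in_itv/= => /andP[ax xb].
  by have := lt_le_trans ba (le_trans ax xb); rewrite ltxx.
have [c _ cM] := EVT_max ab cf; have [d _ dm] := EVT_min ab cf.
exists (`|f c| + `|f d|); first by rewrite addr_ge0.
move=> x xab; rewrite ler_norml; apply/andP; split.
  apply: le_trans (dm _ xab); have := ler_norm (- f d); rewrite normrN.
  have := normr_ge0 (f c); lra.
apply: le_trans (cM _ xab) _; have := ler_norm (f c).
have := normr_ge0 (f d); lra.
Qed.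

Lemma intgMc (a b : R) f g : intg `[a, b] f -> {within `[a, b], continuous g} ->
  intg `[a, b] (fun x => f x * g x).
Proof.
move=> If cg; have [M _ gM] := itv_cont_bounded cg.
by apply: (intgMr _ If (itv_cont_measurable cg) gM).
Qed.

Lemma within_contD (D : set R) f g : {within D, continuous f} ->
  {within D, continuous g} -> {within D, continuous (fun x => f x + g x)}.
Proof. by move=> cf cg x; apply: (@continuousD _ _ (subspace D)); [exact: cf|exact: cg]. Qed.

Lemma within_contM (D : set R) f g : {within D, continuous f} ->
  {within D, continuous g} -> {within D, continuous (fun x => f x * g x)}.
Proof. by move=> cf cg x; apply: (@continuousM _ (subspace D)); [exact: cf|exact: cg]. Qed.

Lemma within_contT (D : set R) f : continuous f -> {within D, continuous f}.
Proof. by move=> cf; exact: continuous_subspaceT. Qed.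

End RealIntegral.

(** * Fubini's theorem for real-valued integrals on rectangles *)

Section Fubini.
Context {R : realType}.
Local Notation mu := (@lebesgue_measure R).
Local Notation mu2 := (mu \x mu)%E.
Local Notation intg D f := (mu.-integrable D (EFin \o f)).
Implicit Types (f g h k : R -> R) (A B : set (measurableTypeR R)).

Lemma Rint_fubini A B (F : R -> R -> R) : measurable A -> measurable B ->
  mu2.-integrable (A `*` B) (fun z => (F z.1 z.2)%:E) ->
  [/\ intg A (fun x => \int[mu]_(y in B) F x y),
      intg B (fun y => \int[mu]_(x in A) F x y),
      \int[mu]_(x in A) (\int[mu]_(y in B) F x y) =
      \int[mu]_(y in B) (\int[mu]_(x in A) F x y),
      {ae mu, forall x, A x -> intg B (F x)} &
      {ae mu, forall y, B y -> intg A (F ^~ y)}].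
Proof.
move=> mA mB IF.
pose f := (fun z => (F z.1 z.2)%:E) \_ (A `*` B).
have If : mu2.-integrable setT f.
  by apply/(integrable_mkcond _ (measurableX mA mB)).
have fE1 x : A x -> (fun y => f (x, y)) = (EFin \o F x) \_ B.
  move=> Ax; apply/funext => y; rewrite /f !patchE.
  have [yB|yB] := boolP (y \in B).
    by rewrite mem_set//; split => //; rewrite inE in yB.
  by rewrite memNset// => -[_ /= By]; rewrite notin_setE in yB.
have fE2 y : B y -> (fun x => f (x, y)) = (EFin \o F ^~ y) \_ A.
  move=> By; apply/funext => x; rewrite /f !patchE.
  have [xA|xA] := boolP (x \in A).
    by rewrite mem_set//; split => //; rewrite inE in xA.
  by rewrite memNset// => -[/= Ax _]; rewrite notin_setE in xA.
have f01 x : ~ A x -> (fun y => f (x, y)) = cst 0%E.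
  move=> nAx; apply/funext => y; rewrite /f patchE memNset//.
  by move=> [].
have f02 y : ~ B y -> (fun x => f (x, y)) = cst 0%E.
  move=> nBy; apply/funext => x; rewrite /f patchE memNset//.
  by move=> [].
have intA x : A x -> (\int[mu]_y f (x, y) = \int[mu]_(y in B) (F x y)%:E)%E.
  by move=> Ax; rewrite [RHS]integral_mkcond (fE1 _ Ax).
have intB y : B y -> (\int[mu]_x f (x, y) = \int[mu]_(x in A) (F x y)%:E)%E.
  by move=> By; rewrite [RHS]integral_mkcond (fE2 _ By).
have I1 : mu.-integrable setT (fun x => \int[mu]_y f (x, y))%E.
  exact: (integrable_fubini_F If).
have mf : measurable_fun setT f by exact: measurable_int If.
have I2 : mu.-integrable setT (fun y => \int[mu]_x f (x, y))%E.
  apply/integrableP; split; first exact: (measurable_fubini_G If).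
  apply: le_lt_trans ((integrable21ltyP mu mu mf).1 If).
  have mG := measurable_fubini_G If.
  apply: ge0_le_integral => //.
  - exact: measurableT_comp.
  - apply: (measurable_fun_fubini_tonelli_G (abse \o f)) => //.
      exact: measurableT_comp.
    by move=> z; exact: abse_ge0.
  - by move=> y _; apply: le_abse_integral => //; exact: measurableT_comp.
(* An integrable [h] is finite almost everywhere, so [fine \o h] differs from it on a null set only;
   non-integrable slices contribute nothing. *)
have main (D : set (measurableTypeR R)) (h : R -> \bar R) : measurable D ->
    mu.-integrable setT h -> (forall x, ~ D x -> h x = 0%E) ->
    intg D (fine \o h) /\ \int[mu]_(x in D) (fine (h x)) = fine (\int[mu]_x h x)%E.
  move=> mD Ih h0.
  have Ih' : mu.-integrable D h by apply: integrableS Ih.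
  have mh : measurable_fun D (fine \o h).
    apply: measurableT_comp; first exact: fine_measurable.
    by case/integrableP : Ih'.
  split.
    apply: (le_integrable mD _ _ Ih'); first exact/measurable_EFinP.
    by move=> x _ /=; case: (h x) => //= [|]; rewrite normr0 leey.
  rewrite /Rintegral; congr fine.
  transitivity (\int[mu]_(x in D) h x)%E.
    apply: ae_eq_integral => //.
    - exact/measurable_EFinP.
    - by case/integrableP : Ih'.
    - apply: filterS (integrable_ae mD Ih') => x hx Dx.
      by rewrite /= fineK//; exact: hx.
  rewrite integral_mkcond; apply: eq_integral => x _; rewrite patchE.
  case: ifPn => // /negP xD; rewrite h0//.
  by move=> Dx; apply: xD; rewrite inE.
have z1 x : ~ A x -> (\int[mu]_y f (x, y) = 0)%E.
  by move=> /f01 ->; exact: integral0.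
have z2 y : ~ B y -> (\int[mu]_x f (x, y) = 0)%E.
  by move=> /f02 ->; exact: integral0.
have [J1 E1] := main _ _ mA I1 z1.
have [J2 E2] := main _ _ mB I2 z2.
split.
- apply: intg_ext J1 => // x Ax /=.
  by rewrite /Rintegral -intA.
- apply: intg_ext J2 => // x Ax /=.
  by rewrite /Rintegral -intB.
- transitivity (\int[mu]_(x in A) fine (\int[mu]_y f (x, y))%E).
    by apply: eq_Rintegral => x /[!inE] Ax; rewrite /Rintegral -intA.
  rewrite E1 (Fubini If) -E2.
  by apply: eq_Rintegral => x /[!inE] Ax; rewrite /Rintegral -intB.
- apply: filterS (ae_integrable1 If) => x Ix Ax.
  by apply/(integrable_mkcond _ mB); rewrite -fE1.
- apply: filterS (ae_integrable2 If) => x Ix Ax.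
  by apply/(integrable_mkcond _ mA); rewrite -fE2.
Qed.

End Fubini.

(** * Calculus of absolutely continuous functions *)

Section AbsoluteContinuity.
Context {R : realType}.
Local Notation mu := (@lebesgue_measure R).
Local Notation mu2 := (mu \x mu)%E.
Local Notation intg D f := (mu.-integrable D (EFin \o f)).
Implicit Types (f g h k : R -> R) (c d x : R).

Lemma measurable_le_indic : measurable_fun setT
  (fun z : measurableTypeR R * measurableTypeR R => ((z.2 <= z.1)%R : bool)%:R : R).
Proof.
apply: (@measurableT_comp _ _ _ _ _ _ (fun b : bool => b%:R : R)) => //.
apply: measurable_fun_ler; [exact: measurable_snd|exact: measurable_fst].
Qed.

(** Tonelli bounds the double integral by the product of the two L^1 norms. [W] will be the
    indicator of a triangle. *)
Lemma intg_prod (A B : set (measurableTypeR R)) g k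
    (W : measurableTypeR R * measurableTypeR R -> R) :
  measurable A -> measurable B -> intg A g -> intg B k ->
  measurable_fun setT W -> (forall z, `|W z| <= 1) ->
  mu2.-integrable (A `*` B) (fun z => (g z.1 * k z.2 * W z)%:E).
Proof.
move=> mA mB Ig Ik mW W1.
pose g' := g \_ A; pose k' := k \_ B.
have Ig' : intg setT g'.
  by rewrite /g' -restrict_EFin; apply/(integrable_mkcond _ mA).
have Ik' : intg setT k'.
  by rewrite /k' -restrict_EFin; apply/(integrable_mkcond _ mB).
have mg : measurable_fun setT g' by exact: intg_measurable.
have mk : measurable_fun setT k' by exact: intg_measurable.
pose f z := (g' z.1 * k' z.2 * W z)%:E.
have mf : measurable_fun setT f.
  apply/measurable_EFinP; apply: measurable_funM => //.
  by apply: measurable_funM; apply: measurableT_comp.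
have Ik1 : intg setT (fun y => `|k' y|) by exact: integrable_norm.
have Ig1 : intg setT (fun y => `|g' y|) by exact: integrable_norm.
pose K := \int[mu]_y `|k' y|.
have If : mu2.-integrable setT f.
  apply/(integrable12ltyP mu mu mf).
  apply: (@le_lt_trans _ _ (\int[mu]_x (`|g' x| * K)%:E)%E); last first.
    by apply: integrable_lty => //; apply: (integrableZr measurableT K Ig1).
  apply: ge0_le_integral => //.
  - by move=> x _; apply: integral_ge0 => y _; exact: abse_ge0.
  - apply: (measurable_fun_fubini_tonelli_F (abse \o f)).
      exact: measurableT_comp.
    by move=> z; exact: abse_ge0.
  - apply/measurable_EFinP; apply: measurable_funM => //.
    exact: intg_measurable.
  - move=> x _; rewrite EFinM /K /Rintegral fineK; last exact: integrable_fin_num.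
    rewrite -integralZl//; apply: ge0_le_integral => //.
    + apply: measurableT_comp => //.
      exact: (measurableT_comp mf (pair1_measurable x)).
    + by apply: measurable_funeM; case/integrableP : Ik1.
    + move=> y _; rewrite /f /= lee_fin !normrM ler_piMr ?mulr_ge0//.
have mAB := measurableX mA mB.
apply: (eq_integrable mAB f); last by apply: integrableS If.
move=> [x y]; rewrite inE => -[/= Ax By]; rewrite /f /g' /k' !patchE.
by rewrite !mem_set.
Qed.

Lemma Rint_indic (A D : set (measurableTypeR R)) (b : R -> bool) g :
  A `<=` D -> (forall x, D x -> b x <-> A x) ->
  \int[mu]_(x in D) (g x * (b x)%:R) = \int[mu]_(x in A) g x.
Proof.
move=> AD bA; rewrite [LHS]Rintegral_mkcond [RHS]Rintegral_mkcond.
apply: eq_Rintegral => x _; rewrite !patchE.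
have [/[!inE] Dx|/negP xD] := boolP (x \in D).
  have [/[!inE] Ax|/negP xA] := boolP (x \in A).
    by have /bA -> := Ax; rewrite ?mulr1.
  case: (boolP (b x)) => [/bA xA'|_]; last by rewrite mulr0.
  by exfalso; apply: xA; rewrite inE; exact: xA'.
case: ifPn => // /[!inE] /AD Dx.
by exfalso; apply: xD; rewrite inE.
Qed.

Lemma Rint_le_indicl c x s g : s \in `[c, x] ->
  \int[mu]_(t in `[c, x]) (g t * (t <= s)%R%:R) = \int[mu]_(t in `[c, s]) g t.
Proof.
rewrite in_itv/= => /andP[cs sx]; apply: Rint_indic => t /=; rewrite !in_itv/=.
  by move=> /andP[-> /le_trans]; exact.
by move=> /andP[-> _].
Qed.

Lemma Rint_le_indicr c x t g : intg `[c, x] g -> t \in `[c, x] ->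
  \int[mu]_(s in `[c, x]) (g s * (t <= s)%R%:R) =
  \int[mu]_(s in `[c, x]) g s - \int[mu]_(s in `[c, t]) g s.
Proof.
rewrite in_itv/= => Ig /andP[ct tx]; rewrite Rintegral_itvB ?bnd_simp//.
rewrite Rintegral_itv_obnd_cbnd//.
  apply: Rint_indic => s /=; rewrite !in_itv/=.
    by move=> /andP[ts ->]; rewrite (le_trans ct ts).
  by move=> /andP[_ ->]; rewrite andbT.
apply: intgS Ig => // s /=; rewrite !in_itv/= => /andP[ts ->].
by rewrite (le_trans ct (ltW ts)).
Qed.

(** Integration by parts with no regularity beyond L^1: Fubini on the triangle [t <= s], where the
    integral of [g] from [t] to [x] is the total minus the part up to [t]. *)
Lemma Rint_triangle c x g k : intg `[c, x] g -> intg `[c, x] k ->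
  \int[mu]_(s in `[c, x]) (g s * \int[mu]_(t in `[c, s]) k t) =
  \int[mu]_(s in `[c, x]) g s * \int[mu]_(t in `[c, x]) k t -
  \int[mu]_(t in `[c, x]) ((\int[mu]_(s in `[c, t]) g s) * k t).
Proof.
move=> Ig Ik.
pose F s t : R := g s * k t * (t <= s)%R%:R.
have W1 (z : measurableTypeR R * measurableTypeR R) :
    `|((z.2 <= z.1)%R : bool)%:R : R| <= 1.
  by have [] := leP z.2 z.1 => _ /=; rewrite ?normr1 ?normr0 ?ler01 ?lexx.
have mI := measurable_itv `[c, x].
have IF := intg_prod mI mI Ig Ik measurable_le_indic W1.
have [_ I2 E _ _] := Rint_fubini (F := F) mI mI IF.
clear IF W1 mI.
have E1 s : s \in `[c, x] ->
    \int[mu]_(t in `[c, x]) F s t = g s * \int[mu]_(t in `[c, s]) k t.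
  clear I2 E => sx; rewrite -(Rint_le_indicl _ sx) -RintegralZl//.
    by apply: eq_Rintegral => t _; rewrite /F mulrA.
  apply: (intgMr _ Ik) => [//||t _]; last first.
    by case: (t <= s); rewrite /= ?normr1 ?normr0.
  apply: (@measurableT_comp _ _ _ _ _ _ (fun b : bool => b%:R : R)) => //.
  by apply: measurable_fun_ler.
have E2 t : t \in `[c, x] -> \int[mu]_(s in `[c, x]) F s t =
    (\int[mu]_(s in `[c, x]) g s - \int[mu]_(s in `[c, t]) g s) * k t.
  clear I2 E => tx; rewrite -(Rint_le_indicr Ig tx) -RintegralZr//.
    by apply: eq_Rintegral => s _; rewrite /F mulrAC.
  apply: (intgMr _ Ig) => [//||s _]; last first.
    by case: (t <= s); rewrite /= ?normr1 ?normr0.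
  apply: (@measurableT_comp _ _ _ _ _ _ (fun b : bool => b%:R : R)) => //.
  by apply: measurable_fun_ler.
transitivity (\int[mu]_(s in `[c, x]) \int[mu]_(t in `[c, x]) F s t).
  by apply: eq_Rintegral => s; rewrite inE => sx; rewrite E1.
rewrite {}E; move: I2 E2; clearbody F; clear E1.
move=> I2 E2; rewrite -RintegralZl// -RintegralB//.
- by apply: eq_Rintegral => t; rewrite inE => tx; rewrite E2// mulrBl.
- exact: intgZl.
- apply: (@intg_ext _ _ (fun t => \int[mu]_(s in `[c, x]) g s * k t -
    \int[mu]_(s in `[c, x]) F s t)) => //.
    by move=> t /= tx; rewrite E2// mulrBl opprB addrC subrK.
  by apply: intgB => //; exact: intgZl.
Qed.

Lemma ac_cont c d f g : ac_deriv c d f g -> {within `[c, d], continuous f}.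
Proof.
move=> [Ig fE]; have [cd|dc] := leP c d; last first.
  rewrite set_itv_ge -?leNgt ?bnd_simp ?lt_geF//.
  exact: continuous_subspace0.
have := parameterized_integral_continuous cd Ig.
move=> /(within_contD (within_contT (D := `[c, d]) (@cst_continuous _ _ (f c)))) H.
apply: (subspace_eq_continuous _ H).
by move=> x /[!inE] xcd; rewrite /from_subspace/= [RHS]fE.
Qed.

(** The constants [h c] and [f c] split off from the two integrals, and [Rint_triangle] relates the
    iterated integrals that remain. *)
Lemma acM c d f g h k : ac_deriv c d f g -> ac_deriv c d h k ->
  ac_deriv c d (fun x => f x * h x) (fun x => g x * h x + f x * k x).
Proof.
move=> acf ach; have cf := ac_cont acf; have ch := ac_cont ach.
move: acf ach => [Ig fE] [Ik hE].
have I1 := intgMc Ig ch.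
have I2 : intg `[c, d] (fun x => f x * k x).
  have [M _ fM] := itv_cont_bounded cf.
  exact: (intgMl _ Ik (itv_cont_measurable cf) fM).
split; first exact: intgD.
move=> x xcd; move: (xcd); rewrite in_itv/= => /andP[cx xd].
have sub : `[c, x]%classic `<=` `[c, d]%classic.
  by move=> z /=; rewrite !in_itv/= => /andP[-> /le_trans]; exact.
have Igx : intg `[c, x] g by apply: intgS Ig.
have Ikx : intg `[c, x] k by apply: intgS Ik.
have I1x : intg `[c, x] (fun x => g x * h x) by apply: intgS I1.
have I2x : intg `[c, x] (fun x => f x * k x) by apply: intgS I2.
rewrite RintegralD//.
have -> : \int[mu]_(y in `[c, x]) (g y * h y) = h c * \int[mu]_(y in `[c, x]) g y +
    \int[mu]_(s in `[c, x]) (g s * \int[mu]_(t in `[c, s]) k t).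
  rewrite -RintegralZl// -RintegralD//.
  - by apply: eq_Rintegral => y /[!inE] yx; rewrite hE; [ring|exact: sub].
  - exact: intgZl.
  - apply: (@intg_ext _ _ (fun y => g y * h y - h c * g y)) => //.
      by move=> y yx; rewrite hE; [ring|exact: sub].
    by apply: intgB => //; exact: intgZl.
have -> : \int[mu]_(y in `[c, x]) (f y * k y) = f c * \int[mu]_(y in `[c, x]) k y +
    \int[mu]_(s in `[c, x]) ((\int[mu]_(t in `[c, s]) g t) * k s).
  rewrite -RintegralZl// -RintegralD//.
  - by apply: eq_Rintegral => y /[!inE] yx; rewrite fE; [ring|exact: sub].
  - exact: intgZl.
  - apply: (@intg_ext _ _ (fun y => f y * k y - f c * k y)) => //.
      by move=> y yx; rewrite fE; [ring|exact: sub].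
    by apply: intgB => //; exact: intgZl.
by rewrite Rint_triangle// (fE x)// (hE x)//; ring.
Qed.

Lemma acD c d f g h k : ac_deriv c d f g -> ac_deriv c d h k ->
  ac_deriv c d (fun x => f x + h x) (fun x => g x + k x).
Proof.
move=> [Ig fE] [Ik hE]; split; first exact: intgD.
move=> x xcd; move: (xcd); rewrite in_itv/= => /andP[cx xd].
have sub : `[c, x]%classic `<=` `[c, d]%classic.
  by move=> z /=; rewrite !in_itv/= => /andP[-> /le_trans]; exact.
rewrite RintegralD//; [|exact: intgS Ig|exact: intgS Ik].
by rewrite fE// hE//; ring.
Qed.

Lemma acZ c d r f g : ac_deriv c d f g ->
  ac_deriv c d (fun x => r * f x) (fun x => r * g x).
Proof.
move=> [Ig fE]; split; first exact: intgZl.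
move=> x xcd; move: (xcd); rewrite in_itv/= => /andP[cx xd].
have sub : `[c, x]%classic `<=` `[c, d]%classic.
  by move=> z /=; rewrite !in_itv/= => /andP[-> /le_trans]; exact.
by rewrite RintegralZl//; [rewrite fE//; ring|exact: intgS Ig].
Qed.

Lemma ac_ext c d f g f' g' : (forall x, x \in `[c, d] -> f x = f' x) ->
  (forall x, x \in `[c, d] -> g x = g' x) -> ac_deriv c d f g -> ac_deriv c d f' g'.
Proof.
move=> ff gg [Ig fE]; split; first exact: intg_ext Ig.
move=> x xcd; move: (xcd); rewrite in_itv/= => /andP[cx xd].
rewrite -(ff x xcd) -(ff c); last by rewrite in_itv/= lexx (le_trans cx xd).
rewrite (fE x xcd); congr (_ + _); apply: eq_Rintegral => y /[!inE]/=; rewrite in_itv/= => /andP[cy yx].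
by apply: gg; rewrite in_itv/= cy (le_trans yx xd).
Qed.

Lemma ac_expR c d (r : R) :
  ac_deriv c d (fun x => expR (r * x)) (fun x => r * expR (r * x)).
Proof.
have der x : is_derive x 1 (fun x => expR (r * x)) (r * expR (r * x)).
  have /= h := is_derive1_comp (f := expR) (g := fun x => r * x) (x := x).
  have hm : is_derive x 1 (fun x => r * x) r.
    by apply: is_derive_eq; rewrite /GRing.scale/= mulr1.
  by rewrite mulrC; exact: h (is_derive_expR (r * x)) hm.
have cont0 : continuous (fun x => expR (r * x)).
  by move=> x; apply/differentiable_continuous/derivable1_diffP; case: (der x).
have cont : continuous (fun x => r * expR (r * x)).
  by move=> x; apply: cvgM; [exact: cvg_cst|exact: cont0].
split.
  apply: continuous_compact_integrable; first exact: segment_compact.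
  exact: within_contT.
move=> x; rewrite in_itv/= => /andP[]; rewrite le_eqVlt => /predU1P[<- _|cx _].
  by rewrite set_itv1 Rintegral_set1 addr0.
rewrite /Rintegral (@continuous_FTC2 _ _ (fun x => expR (r * x)))//=.
- by rewrite addrCA subrr addr0.
- exact: within_contT.
- split => [y _||]; first by case: (der y).
  + by apply: cvg_at_right_filter; exact: cont0.
  + by apply: cvg_at_left_filter; exact: cont0.
- by move=> y _; rewrite derive1E; case: (der y).
Qed.

End AbsoluteContinuity.

(** * The Volterra equation for rescaled Sturm-Liouville solutions *)

Section Volterra.
Context {R : realType}.
Local Notation mu := (@lebesgue_measure R).
Local Notation intg D f := (mu.-integrable D (EFin \o f)).
Implicit Types (q f g h : R -> R) (x z : R).

(* With h x = expR (z x / 2) * w x, the equation h'' = (q + (z / 2)^2) h becomes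
   w'' + z w' = q w; tau is the kernel that inverts the left-hand side. *)
Definition tau (z d : R) : R := (1 - expR (- (z * d))) / z.

Definition l1norm q : R := \int[mu]_(x in `[0, 1]) `|q x|.

Lemma l1norm_ge0 q : 0 <= l1norm q.
Proof. by apply: Rintegral_ge0 => x _; exact: normr_ge0. Qed.

Lemma tau_ge0 z d : 0 < z -> 0 <= d -> 0 <= tau z d.
Proof.
move=> z0 d0; rewrite divr_ge0 ?(ltW z0)// subr_ge0 -expR0 ler_expR oppr_le0.
by rewrite mulr_ge0// ltW.
Qed.

Lemma tau_le z d : 0 < z -> tau z d <= z^-1.
Proof.
by move=> z0; rewrite /tau ler_pdivrMr// mulVf ?gt_eqF// gerBl expR_ge0.
Qed.

Definition volterra q z h x : R :=
  \int[mu]_(s in `[0, x]) (tau z (x - s) * (q s * h s)).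

Section operator.
Variables (q : R -> R) (z : R).
Hypotheses (Iq : intg `[0, 1] q) (z0 : 0 < z).

Lemma intg_q h (M : R) : measurable_fun `[(0 : R), 1] h ->
  (forall x, x \in `[0, 1] -> `|h x| <= M) -> intg `[0, 1] (fun s => q s * h s).
Proof. by move=> mh hM; exact: (intgMr (M := M)). Qed.

Lemma sub01 x : x <= 1 -> (`[0, x]%classic : set R) `<=` `[0, 1]%classic.
Proof. by move=> x1 y /=; rewrite !in_itv/= => /andP[-> /le_trans]; exact. Qed.

(** The kernel [tau z (x - s)] is a sum of two products of a function of [x] and a function of [s].
    Regularity in [x] thus reduces to that of indefinite integrals and one exponential. *)
Lemma volterraE h x : intg `[0, 1] (fun s => q s * h s) -> x \in `[0, 1] ->
  volterra q z h x = \int[mu]_(s in `[0, x]) (z^-1 * (q s * h s)) +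
   expR (- z * x) * \int[mu]_(s in `[0, x]) (- (z^-1) * (q s * h s * expR (z * s))).
Proof.
rewrite in_itv/= => I1 /andP[x0 x1].
have I2 : intg `[0, 1] (fun s => q s * h s * expR (z * s)).
  by apply: intgMc I1 _; exact: ac_cont (ac_expR 0 1 z).
have J1 := intgS (measurable_itv _) (measurable_itv _) (sub01 x1) I1.
have J2 := intgS (measurable_itv _) (measurable_itv _) (sub01 x1) I2.
rewrite -RintegralZl//; last exact: intgZl.
rewrite -RintegralD//; [|exact: intgZl|by apply: intgZl => //; exact: intgZl].
apply: eq_Rintegral => s _; rewrite /tau.
rewrite (_ : - (z * (x - s)) = - z * x + z * s); last by ring.
by rewrite expRD; field; rewrite gt_eqF.
Qed.

Lemma intg_volterra h x : intg `[0, 1] (fun s => q s * h s) -> x \in `[0, 1] ->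
  intg `[0, x] (fun s => tau z (x - s) * (q s * h s)).
Proof.
rewrite in_itv/= => I1 /andP[x0 x1].
have J1 := intgS (measurable_itv _) (measurable_itv _) (sub01 x1) I1.
apply: (intgMl (M := z^-1)) => // [|s]/=.
  apply: measurable_funM => //; apply: measurable_funB => //.
  apply: (measurableT_comp (f := expR)) => //.
  apply: measurable_funN; apply: measurable_funM => //.
  exact: measurable_funB.
rewrite in_itv/= => /andP[s0 sx].
have t0 : 0 <= tau z (x - s) by rewrite tau_ge0// subr_ge0.
  by rewrite (ger0_norm t0) tau_le.
Qed.

Lemma volterra_bound h (M : R) x : intg `[0, 1] (fun s => q s * h s) ->
  (forall x, x \in `[0, 1] -> `|h x| <= M) -> x \in `[0, 1] ->
  `|volterra q z h x| <= l1norm q / z * M.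
Proof.
move=> I1 hM x01; have I2 := intg_volterra I1 x01.
move: (x01); rewrite in_itv/= => /andP[x0 x1].
have M0 : 0 <= M by apply: le_trans (hM _ x01); exact: normr_ge0.
have Iq1 : intg `[0, 1] (fun s => `|q s|) by exact: integrable_norm.
have Iqx := intgS (measurable_itv _) (measurable_itv _) (sub01 x1) Iq1.
apply: le_trans (norm_Rint_le (g := fun s => M / z * `|q s|) _ I2 _ _) _ => //.
- exact: intgZl.
- move=> s /=; rewrite in_itv/= => /andP[s0 sx].
  rewrite normrM [`|q s * h s|]normrM (_ : M / z * `|q s| = z^-1 * (`|q s| * M)); last by ring.
  have s01 : s \in `[0, 1] by rewrite in_itv/= s0 (le_trans sx).
  apply: ler_pM; rewrite ?mulr_ge0//; last by rewrite ler_wpM2l// hM.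
  have t0 : 0 <= tau z (x - s) by rewrite tau_ge0// subr_ge0.
  by rewrite (ger0_norm t0) tau_le.
- rewrite RintegralZl// (_ : l1norm q / z * M = M / z * l1norm q); last by ring.
  rewrite ler_wpM2l ?divr_ge0 ?(ltW z0)//.
  by apply: Rint_le_subset => //; exact: sub01.
Qed.

Lemma volterra_cont h : intg `[0, 1] (fun s => q s * h s) ->
  {within `[0, 1], continuous (volterra q z h)}.
Proof.
move=> I1; have I2 : intg `[0, 1] (fun s => q s * h s * expR (z * s)).
  by apply: intgMc I1 _; exact: ac_cont (ac_expR 0 1 z).
have c1 := parameterized_integral_continuous ler01 (intgZl z^-1 (measurable_itv _) I1).
have c2 := parameterized_integral_continuous ler01 (intgZl (- z^-1) (measurable_itv _) I2).
have c3 := within_contM (ac_cont (ac_expR 0 1 (- z))) c2.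
apply: (subspace_eq_continuous _ (within_contD c1 c3)).
by move=> x /[!inE] x01; apply/esym; exact: volterraE.
Qed.

Lemma volterraB h k x : intg `[0, 1] (fun s => q s * h s) ->
  intg `[0, 1] (fun s => q s * k s) -> x \in `[0, 1] ->
  volterra q z h x - volterra q z k x = volterra q z (fun s => h s - k s) x.
Proof.
move=> Ih Ik x01; rewrite /volterra -RintegralB//; [|exact: intg_volterra..].
by apply: eq_Rintegral => s _; ring.
Qed.

End operator.

(** The solutions of [w'' + z w' = 0], the case [q = 0]: [c1] weighs the growing wave and [c2] the
    decaying one. *)
Definition expwave z (c1 c2 : R) x : R := c1 + c2 * expR (- z * x).

Fixpoint picard q z (c1 c2 : R) n : R -> R :=
  if n is n'.+1 then fun x => expwave z c1 c2 x + volterra q z (picard q z c1 c2 n') x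
  else expwave z c1 c2.

Definition vsol q z (c1 c2 : R) x : R := limn (fun n => picard q z c1 c2 n x).

Section solution.
Variables (q : R -> R) (z c1 c2 : R).
Hypotheses (Iq : intg `[0, 1] q) (z0 : 0 < z) (qz : 2 * l1norm q <= z).
Let G : R := `|c1| + `|c2|.
Let P := picard q z c1 c2.

Lemma expwave_cont : {within `[0, 1], continuous (expwave z c1 c2)}.
Proof.
apply: within_contD; first by apply: within_contT; exact: cst_continuous.
apply: within_contM; first by apply: within_contT; exact: cst_continuous.
exact: ac_cont (ac_expR 0 1 (- z)).
Qed.

Lemma expwave_bound x : 0 <= x -> `|expwave z c1 c2 x| <= G.
Proof.
move=> x0; rewrite (le_trans (ler_normD _ _))// lerD2l normrM ler_piMr//.
rewrite ger0_norm ?expR_ge0// -expR0 ler_expR mulNr oppr_le0 mulr_ge0//.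
exact: ltW.
Qed.

Lemma picard_cont n : {within `[0, 1], continuous (P n)}.
Proof.
elim: n => [|n IHn]; first exact: expwave_cont.
apply: within_contD; first exact: expwave_cont.
by apply: volterra_cont => //; exact: intgMc.
Qed.

Let IqP n : intg `[0, 1] (fun s => q s * P n s).
Proof. by apply: intgMc => //; exact: picard_cont. Qed.

Let half : l1norm q / z <= 2^-1.
Proof. by rewrite ler_pdivrMr// ler_pdivlMl. Qed.

Let G0 : 0 <= G. Proof. by rewrite addr_ge0. Qed.

Lemma picardB n x : x \in `[0, 1] -> `|P n.+1 x - P n x| <= G * 2^-1 ^+ n.+1.
Proof.
elim: n x => [|n IHn] x x01.
  rewrite /P /= addrC addKr expr1 mulrC.
  apply: le_trans (volterra_bound (M := G) _ _ _ _ _) _ => //.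
  - exact: (IqP 0).
  - by move=> y; rewrite in_itv/= => /andP[y0 _]; exact: expwave_bound.
  - by rewrite ler_wpM2r.
have -> : P n.+2 x - P n.+1 x = volterra q z (P n.+1) x - volterra q z (P n) x.
  by rewrite /P /=; ring.
rewrite volterraB//.
rewrite (le_trans (volterra_bound (M := G * 2^-1 ^+ n.+1) _ _ _ _ _))//.
- apply: (@intg_ext _ _ (fun s => q s * P n.+1 s - q s * P n s)) => //.
    by move=> y _; ring.
  exact: intgB.
- have -> : G * 2^-1 ^+ n.+2 = 2^-1 * (G * 2^-1 ^+ n.+1) by rewrite exprS mulrCA.
  by apply: ler_wpM2r => //; rewrite mulr_ge0// exprn_ge0.
Qed.

Lemma picard_cvg x : x \in `[0, 1] -> cvgn (fun n => P n x).
Proof.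
move=> x01; pose u n := P n.+1 x - P n x.
have cu : cvgn (series u).
  apply: normed_cvg.
  apply: (@series_le_cvg _ _ (geometric (G / 2) 2^-1)) => //=.
  - by move=> n; rewrite mulr_ge0 ?exprn_ge0 ?divr_ge0 ?invr_ge0.
  - by move=> n; have := picardB n x01; rewrite exprS mulrA.
  - by apply: is_cvg_geometric_series; rewrite ger0_norm; lra.
have -> : (fun n => P n x) = (fun n => P 0%N x + series u n).
  apply/funext => n; rewrite /series/= /u telescope_sumr//.
  by rewrite addrC subrK.
by apply: is_cvgD => //; exact: is_cvg_cst.
Qed.

Lemma picard_bound n x : x \in `[0, 1] -> `|P n x| <= 2 * G.
Proof.
elim: n x => [|n IHn] x x01; move: (x01); rewrite in_itv/= => /andP[x0 _].
  by rewrite (le_trans (expwave_bound x0))//; have := G0; lra.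
have vb := volterra_bound Iq z0 (IqP n) IHn x01.
rewrite (le_trans (ler_normD _ _))// (_ : 2 * G = G + G); last by ring.
rewrite lerD ?expwave_bound// (le_trans vb)//.
by have := ler_wpM2r G0 half; lra.
Qed.

Let w := vsol q z c1 c2.

Lemma vsol_bound x : x \in `[0, 1] -> `|w x| <= 2 * G.
Proof.
move=> x01; have /cvg_norm := picard_cvg x01.
move=> cv; rewrite /w /vsol -(cvg_lim _ cv)//.
apply: limr_le; first exact: cvgP cv.
by apply: nearW => n; exact: picard_bound.
Qed.

Lemma vsol_measurable : measurable_fun `[(0 : R), 1] w.
Proof.
apply: (@measurable_fun_cvg _ _ _ _ P) => [n|x x01].
  exact: itv_cont_measurable (@picard_cont n).
exact: picard_cvg.
Qed.

Lemma intg_vsol : intg `[0, 1] (fun s => q s * w s).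
Proof. by apply: (intg_q Iq vsol_measurable); exact: vsol_bound. Qed.

Lemma vsolE x : x \in `[0, 1] -> w x = expwave z c1 c2 x + volterra q z w x.
Proof.
move=> x01; have cv := picard_cvg x01.
have : (fun n => P n.+1 x) @ \oo --> w x.
  by rewrite (cvg_shiftS (fun n => P n x)).
have : (fun n => P n.+1 x) @ \oo --> expwave z c1 c2 x + volterra q z w x.
  apply: cvgD; first exact: cvg_cst.
  move: (x01); rewrite in_itv/= => /andP[x0 x1].
  (* The Picard iterates are bounded by [2 * G] uniformly in [n] and [tau] by [1 / z], which
     supplies the dominating function. *)
  have [|||||//] := @Rint_cvg _ `[0, x] (fun n s => tau z (x - s) * (q s * P n s))
    (fun s => tau z (x - s) * (q s * w s)) (fun s => z^-1 * (`|q s| * (2 * G))) => //.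
  - by move=> n; apply: intg_measurable; exact: intg_volterra.
  - apply: intgZl => //; apply: (intgMr (M := 2 * G)) => //.
      apply: integrable_norm; apply: intgS Iq => //; exact: sub01.
    by move=> _ _; rewrite ger0_norm// mulr_ge0.
  - move=> s s0x; have s01 := sub01 x1 s0x.
    apply: cvgM; first exact: cvg_cst.
    by apply: cvgM; [exact: cvg_cst|exact: picard_cvg].
  - move=> n s s0x; have s01 := sub01 x1 s0x.
    rewrite normrM [`|q s * _|]normrM; apply: ler_pM; rewrite ?mulr_ge0//; last first.
      by rewrite ler_wpM2l// picard_bound.
    move: s0x; rewrite /= in_itv/= => /andP[s0 sx].
    have t0 : 0 <= tau z (x - s) by rewrite tau_ge0// subr_ge0.
    by rewrite (ger0_norm t0) tau_le.
by move=> /(@cvg_unique _ (@Rhausdorff R) _ _ _ _ _) /[apply].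
Qed.

Lemma vsol_cont : {within `[0, 1], continuous w}.
Proof.
have := volterra_cont z0 intg_vsol.
move=> /(within_contD expwave_cont); apply: subspace_eq_continuous.
by move=> x /[!inE] x01; apply/esym; exact: vsolE.
Qed.

Lemma vsol_near x : x \in `[0, 1] ->
  `|w x - expwave z c1 c2 x| <= l1norm q / z * (2 * G).
Proof.
move=> x01; rewrite vsolE// addrC addKr volterra_bound//.
  exact: intg_vsol.
exact: vsol_bound.
Qed.

Lemma vsol_ode : exists h1 : R -> R,
  let h := fun x => expR (z / 2 * x) * w x in
  [/\ ac_deriv 0 1 h h1,
      ac_deriv 0 1 h1 (fun x => (q x + (z / 2) ^+ 2) * h x),
      h 0 = c1 + c2 & h1 0 = z / 2 * (c1 - c2)].
Proof.
have I1 := intg_vsol.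
have I2 : intg `[0, 1] (fun s => q s * w s * expR (z * s)).
  by apply: intgMc I1 _; exact: ac_cont (ac_expR 0 1 z).
(* Variation of constants: [w = al + be * expR (- z x)]. These derivatives satisfy [al' * expR (z x
   / 2) + be' * expR (- z x / 2) = 0], so [h1] contains no derivative of [al] or [be] and can be
   differentiated again. *)
pose al' s := z^-1 * (q s * w s); pose be' s := - z^-1 * (q s * w s * expR (z * s)).
pose al x := c1 + \int[mu]_(s in `[0, x]) al' s.
pose be x := c2 + \int[mu]_(s in `[0, x]) be' s.
have acal : ac_deriv 0 1 al al'.
  split=> [|x _]; first exact: intgZl.
  by rewrite /al set_itv1 Rintegral_set1 addr0.
have acbe : ac_deriv 0 1 be be'.
  split=> [|x _]; first exact: intgZl.
  by rewrite /be set_itv1 Rintegral_set1 addr0.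
have ep := ac_expR 0 1 (z / 2); have em := ac_expR 0 1 (- (z / 2)).
have wE x : x \in `[0, 1] -> w x = al x + be x * expR (- z * x).
  by move=> x01; rewrite vsolE// volterraE// /al /be /expwave; ring.
have E1 x : expR (z * x) = expR (z / 2 * x) * expR (z / 2 * x).
  by rewrite -expRD -mulrDl -splitr.
have E2 x : expR (- (z / 2) * x) = (expR (z / 2 * x))^-1.
  by rewrite mulNr expRN.
have E3 x : expR (- z * x) = (expR (z / 2 * x))^-1 * (expR (z / 2 * x))^-1.
  by rewrite mulNr expRN E1 invfM.
have en x : expR (z / 2 * x) != 0 by rewrite gt_eqF ?expR_gt0.
have zn : z != 0 by rewrite gt_eqF.
exists (fun x => z / 2 * (al x * expR (z / 2 * x) - be x * expR (- (z / 2) * x))).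
split.
- apply: ac_ext (acD (acM acal ep) (acM acbe em)) => x x01.
    by rewrite wE// E2 E3; field.
  by rewrite /al' /be' E1 E2; field; rewrite zn en.
- apply: ac_ext (acZ (z / 2) (acD (acM acal ep) (acZ (-1) (acM acbe em)))) => x x01.
    by ring.
  have -> : (q x + (z / 2) ^+ 2) * (expR (z / 2 * x) * w x) =
      q x * (expR (z / 2 * x) * w x) + (z / 2) ^+ 2 * (expR (z / 2 * x) *
        (al x + be x * ((expR (z / 2 * x))^-1 * (expR (z / 2 * x))^-1))).
    by rewrite mulrDl; congr (_ + _ * (_ * _)); rewrite wE// E3.
  by rewrite /al' /be' E1 E2; field; rewrite zn en.
- by rewrite mulr0 expR0 mul1r wE ?in_itv/= ?lexx ?ler01// /al /be set_itv1
   !Rintegral_set1 mulr0 expR0; ring.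
- by rewrite /al /be set_itv1 !Rintegral_set1 !mulr0 expR0; ring.
Qed.

End solution.
End Volterra.

(** * Wronskians and the linear bound on the product integral *)

Section Wronskian.
Context {R : realType}.
Local Notation mu := (@lebesgue_measure R).
Local Notation intg D f := (mu.-integrable D (EFin \o f)).
Implicit Types (q f g h : R -> R) (x z : R).

(** Iterating [step] from the crude bound [b] gives [2 e + (b - 2 e) / 2^n]. Half of a bound is thus
    absorbed without forming a supremum. *)
Lemma halving (T : Type) (D : T -> Prop) (f : T -> R) (b e : R) :
  (forall t, D t -> f t <= b) ->
  (forall b, (forall t, D t -> f t <= b) -> forall t, D t -> f t <= b / 2 + e) ->
  forall t, D t -> f t <= 2 * e.
Proof.
move=> fb step t Dt.
have H n : forall t, D t -> f t <= 2 * e + (b - 2 * e) * 2^-1 ^+ n.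
  elim: n => [|n IHn] u Du; first by have := fb _ Du; lra.
  by have := step _ IHn _ Du; rewrite exprS; lra.
have cv : (2 * e + (b - 2 * e) * 2^-1 ^+ n) @[n --> \oo] --> 2 * e.
  rewrite -[X in _ --> X]addr0 -(mulr0 (b - 2 * e)).
  apply: cvgD; first exact: cvg_cst.
  apply: cvgM; first exact: cvg_cst.
  by apply: cvg_expr; rewrite ger0_norm; lra.
by apply: (cvgr_to_ge cv); apply: nearW => n; exact: H.
Qed.

(** The derivative of [f * g1 - f1 * g] is [(q2 - q1) * f * g], the spectral terms [l * f * g]
    cancelling. *)
Lemma ac_wronskian f f1 g g1 q1 q2 (l : R) :
  intg `[0, 1] q1 -> intg `[0, 1] q2 ->
  ac_deriv 0 1 f f1 -> ac_deriv 0 1 f1 (fun x => (q1 x + l) * f x) ->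
  ac_deriv 0 1 g g1 -> ac_deriv 0 1 g1 (fun x => (q2 x + l) * g x) ->
  f 1 * g1 1 - f1 1 * g 1 = f 0 * g1 0 - f1 0 * g 0 +
    \int[mu]_(x in `[0, 1]) ((q2 x - q1 x) * (f x * g x)).
Proof.
move=> I1 I2 acf acf1 acg acg1.
have [_ /(_ 1)] := acD (acM acf acg1) (acZ (-1) (acM acf1 acg)).
rewrite in_itv/= lexx ler01 => /(_ isT) E.
rewrite (_ : _ - _ = f 1 * g1 1 + -1 * (f1 1 * g 1)); last by ring.
rewrite E; congr (_ + _); first by ring.
by apply: eq_Rintegral => x _; ring.
Qed.

(* expR (z x / 2) * jost q z x solves h'' = (q + (z / 2)^2) h and grows like
   expR (z x / 2). *)
Definition jost q z : R -> R := vsol q z 1 0.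

(* Makes the Volterra operator a contraction with ratio 1 / 16, leaving room for
   the lower bound in dirichlet_solution. *)
Definition large q z := (2 <= z) && (16 * l1norm q <= z).

Lemma large_gt0 q z : large q z -> 0 < z.
Proof. by move=> /andP[]; lra. Qed.

Lemma large2 q z : large q z -> 2 * l1norm q <= z.
Proof. by move=> /andP[_]; have := l1norm_ge0 q; lra. Qed.

Lemma jost_bound q z x : intg `[0, 1] q -> large q z -> x \in `[0, 1] ->
  `|jost q z x| <= 2.
Proof.
move=> Iq lz x01; have := vsol_bound 1 0 Iq (large_gt0 lz) (large2 lz) x01.
by rewrite normr1 normr0 addr0 mulr1.
Qed.

Lemma jostE q z x : intg `[0, 1] q -> large q z -> x \in `[0, 1] ->
  jost q z x = 1 + volterra q z (jost q z) x.
Proof.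
move=> Iq lz x01; rewrite [LHS]vsolE ?large2 ?(large_gt0 lz)//.
by rewrite /expwave mul0r addr0.
Qed.

Lemma jost_cont q z : intg `[0, 1] q -> large q z ->
  {within `[0, 1], continuous (jost q z)}.
Proof. by move=> Iq lz; apply: vsol_cont; rewrite ?large2 ?(large_gt0 lz). Qed.

Definition jost_product q1 q2 z : R :=
  \int[mu]_(x in `[0, 1]) ((q2 x - q1 x) * (expR (z * x) * (jost q1 z x * jost q2 z x))).

(** The weights [1 / z] and [- 1 / z] give value 0 and slope 1 at 0. At 1 the free part is at least
    [(2 / 3) / z], since [z >= 2] forces [expR (- z) <= 1 / 3], and the Volterra correction is at
    most [1 / (4 z)], since [l1norm q / z <= 1 / 16]. *)
Lemma dirichlet_solution q z : intg `[0, 1] q -> large q z ->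
  exists f f1 : R -> R,
  [/\ ac_deriv 0 1 f f1, ac_deriv 0 1 f1 (fun x => (q x + (z / 2) ^+ 2) * f x),
      f 0 = 0, f1 0 = 1 & expR (z / 2) / (4 * z) <= f 1].
Proof.
move=> Iq lz; have z0 := large_gt0 lz.
have [f1 [acf acf1 f0 f10]] := vsol_ode z^-1 (- z^-1) Iq z0 (large2 lz).
exists (fun x => expR (z / 2 * x) * vsol q z z^-1 (- z^-1) x), f1; split=> //.
- by rewrite f0; ring.
- by rewrite f10; field; rewrite gt_eqF.
rewrite mulr1 ler_wpM2l ?expR_ge0//.
have := @vsol_near _ q z z^-1 (- z^-1) Iq z0 (large2 lz) 1.
rewrite in_itv/= lexx ler01 => /(_ isT).
rewrite /expwave mulr1 normrN [`|z^-1|]ger0_norm ?invr_ge0 ?(ltW z0)//.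
set s := vsol _ _ _ _ _; rewrite ler_norml => /andP[+ _].
have e3 : expR (- z) <= 3^-1.
  rewrite expRN lef_pV2 ?posrE ?expR_gt0//.
  by have := expR_ge1Dx z; move: lz => /andP[]; lra.
have zi0 : 0 < z^-1 by rewrite invr_gt0.
have zz : z * z^-1 = 1 by rewrite divff// gt_eqF.
have nz : l1norm q / z <= 16^-1.
  by rewrite ler_pdivrMr// ler_pdivlMl//; case/andP: lz.
have -> : (4 * z)^-1 = 4^-1 * z^-1 by rewrite invfM.
have := ler_wpM2r (ltW zi0) nz.
have := ler_wpM2r (ltW zi0) e3.
lra.
Qed.

(* A and B fix the logarithmic derivative at 1 of the Dirichlet solutions p1, p2, so
   the Wronskian of the growing solutions at 1, which jost_product computes, is
   reduced to their quotients by p1 and p2. *)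
Lemma jost_product_le q1 q2 z (A B : R) :
  intg `[0, 1] q1 -> intg `[0, 1] q2 -> large q1 z -> large q2 z -> A != 0 ->
  (forall f f1, ac_deriv 0 1 f f1 ->
    ac_deriv 0 1 f1 (fun x => (q1 x + (z / 2) ^+ 2) * f x) -> f 0 = 0 ->
    B * f 1 = A * f1 1) ->
  (forall f f1, ac_deriv 0 1 f f1 ->
    ac_deriv 0 1 f1 (fun x => (q2 x + (z / 2) ^+ 2) * f x) -> f 0 = 0 ->
    B * f 1 = A * f1 1) ->
  `|jost_product q1 q2 z| <= 16 * z.
Proof.
move=> I1 I2 l1 l2 A0 H1 H2; have z0 := large_gt0 l1.
have [p1 [p1' [acp1 acp1' p10 p1'0 p1b]]] := dirichlet_solution I1 l1.
have [p2 [p2' [acp2 acp2' p20 p2'0 p2b]]] := dirichlet_solution I2 l2.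
have {}H1 := H1 _ _ acp1 acp1' p10; have {}H2 := H2 _ _ acp2 acp2' p20.
have [f1' /= [acf1 acf1' f10 f1'0]] := vsol_ode 1 0 I1 z0 (large2 l1).
have [f2' /= [acf2 acf2' f20 f2'0]] := vsol_ode 1 0 I2 z0 (large2 l2).
(* For equal potentials the Wronskian is constant, and the values at 0 make [W1] and [W2] equal to
   1. In [W] the contribution of 0 vanishes, both growing solutions having value 1 and slope [z / 2]
   there. *)
have W1 := ac_wronskian I1 I1 acf1 acf1' acp1 acp1'.
have W2 := ac_wronskian I2 I2 acf2 acf2' acp2 acp2'.
have W := ac_wronskian I1 I2 acf1 acf1' acf2 acf2'.
have E0 (q : R -> R) (k : R -> R) :
    \int[mu]_(x in `[0, 1]) ((q x - q x) * k x) = 0.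
  under eq_Rintegral do rewrite subrr mul0r.
  by rewrite Rintegral_cst// mul0r.
rewrite E0 in W1; rewrite E0 in W2.
rewrite /= in W1 W2 W.
rewrite f10 p1'0 p10 in W1; rewrite f20 p2'0 p20 in W2.
rewrite f10 f2'0 f1'0 f20 in W.
rewrite !mulr1 in W1 W2 W.
have e0 : 0 < expR (z / 2) by exact: expR_gt0.
set e := expR (z / 2) in p1b p2b W1 W2 W e0.
have v1b : `|jost q1 z 1| <= 2 by rewrite jost_bound// in_itv/= lexx ler01.
have v2b : `|jost q2 z 1| <= 2 by rewrite jost_bound// in_itv/= lexx ler01.
rewrite -/(jost q1 z) -/(jost q2 z) in W1 W2 W.
set v1 := jost q1 z 1 in W1 W v1b; set v2 := jost q2 z 1 in W2 W v2b.
have WI : jost_product q1 q2 z = e * v1 * f2' 1 - f1' 1 * (e * v2).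
  rewrite W [X in _ = X + _](_ : _ = 0) ?add0r; last by ring.
  apply: eq_Rintegral => x _.
  rewrite (_ : z * x = z / 2 * x + z / 2 * x); last by field.
  by rewrite expRD -/(jost q1 z) -/(jost q2 z); ring.
have q0 : 0 < e / (4 * z) by rewrite divr_gt0// mulr_gt0.
have p1n : 0 < p1 1 by apply: lt_le_trans p1b.
have p2n : 0 < p2 1 by apply: lt_le_trans p2b.
have W12 : p1' 1 * p2 1 = p2' 1 * p1 1.
  apply: (mulfI A0); rewrite !mulrA -H1 -H2; ring.
(* After multiplication by [p1 1 * p2 1] the slopes of the growing solutions are eliminated by [W1]
   and [W2], and the terms quadratic in [e] cancel by [W12]. *)
have -> : jost_product q1 q2 z = e * v2 / p1 1 - e * v1 / p2 1.
  have n1 : p1 1 != 0 by rewrite gt_eqF.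
  have n2 : p2 1 != 0 by rewrite gt_eqF.
  have F1 : f1' 1 * p1 1 = e * v1 * p1' 1 - 1 by move: W1; lra.
  have F2 : f2' 1 * p2 1 = e * v2 * p2' 1 - 1 by move: W2; lra.
  apply: (mulIf n1); apply: (mulIf n2).
  transitivity (e * v1 * (f2' 1 * p2 1) * p1 1 - f1' 1 * p1 1 * e * v2 * p2 1).
    by rewrite WI; ring.
  rewrite F1 F2.
  transitivity (e * v1 * e * v2 * (p2' 1 * p1 1 - p1' 1 * p2 1) +
    (e * v2 * p2 1 - e * v1 * p1 1)); first by ring.
  by rewrite W12 subrr; field; rewrite n1 n2.
(* A growing solution is at most [2 e] at 1 and a Dirichlet solution at least [e / (4 z)]: each
   quotient is at most [8 z]. *)
have bnd (v p : R) : `|v| <= 2 -> e / (4 * z) <= p -> `|e * v / p| <= 8 * z.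
  move=> vb pb; have p0 := lt_le_trans q0 pb.
  rewrite normrM normfV (gtr0_norm p0) ler_pdivrMr// normrM (gtr0_norm e0).
  apply: (@le_trans _ _ (e * 2)); first by rewrite ler_wpM2l// ltW.
  apply: (@le_trans _ _ (8 * z * (e / (4 * z)))).
    by rewrite le_eqVlt; apply/orP; left; apply/eqP; field; rewrite gt_eqF.
  by rewrite ler_wpM2l// mulr_ge0// ltW.
have := bnd _ _ v2b p1b; have := bnd _ _ v1b p2b.
have := ler_normB (e * v2 / p1 1) (e * v1 / p2 1).
by lra.
Qed.

End Wronskian.

(** * Continuous dependence on the spectral parameter *)

Section Continuity.
Context {R : realType}.
Local Notation mu := (@lebesgue_measure R).
Local Notation intg D f := (mu.-integrable D (EFin \o f)).
Implicit Types (q f g h : R -> R) (x z : R).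

Lemma expRN_lip (a b : R) : 0 <= a -> 0 <= b ->
  `|expR (- a) - expR (- b)| <= `|a - b|.
Proof.
wlog ab : a b / a <= b.
  move=> H a0 b0; have [ab|/ltW ba] := leP a b; first exact: H.
  by rewrite distrC [leRHS]distrC H.
move=> a0 b0; rewrite ger0_norm ?subr_ge0 ?ler_expR ?lerN2//.
rewrite distrC ger0_norm ?subr_ge0//.
have -> : expR (- b) = expR (- a) * expR (- (b - a)) by rewrite -expRD; congr expR; ring.
have := expR_ge1Dx (- (b - a)).
have e1 : expR (- a) <= 1 by rewrite -expR0 ler_expR oppr_le0.
have e0 := expR_ge0 (- a).
have : expR (- (b - a)) <= 1 by rewrite -expR0 ler_expR oppr_le0 subr_ge0.
by nra.
Qed.

Lemma tau_lip z z' d : 1 <= z -> 1 <= z' -> 0 <= d -> d <= 1 ->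
  `|tau z d - tau z' d| <= 2 * `|z - z'|.
Proof.
move=> z1 z'1 d0 d1.
have z0 : 0 < z by lra.
have z'0 : 0 < z' by lra.
have lip : `|expR (- (z * d)) - expR (- (z' * d))| <= `|z - z'|.
  apply: le_trans (expRN_lip _ _) _; rewrite ?mulr_ge0 ?(ltW z0) ?(ltW z'0)//.
  by rewrite -mulrBl normrM (ger0_norm d0) ler_piMr.
have -> : tau z d - tau z' d = ((z' - z) / z' * tau z d
    - (expR (- (z * d)) - expR (- (z' * d))) / z').
  by rewrite /tau; field; rewrite !gt_eqF.
have iz : z^-1 <= 1 by rewrite invf_le1.
have iz' : z'^-1 <= 1 by rewrite invf_le1.
have iz'0 : 0 <= z'^-1 by rewrite invr_ge0 ltW.
rewrite (le_trans (ler_normB _ _))// (_ : 2 * _ = `|z - z'| + `|z - z'|); last by ring.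
rewrite lerD//.
  rewrite normrM (ger0_norm (tau_ge0 z0 d0)) normrM [`|z'^-1|]ger0_norm// distrC.
  rewrite -mulrA ler_piMr// -[leRHS]mulr1 ler_pM// ?(tau_ge0 z0 d0)//.
  exact: le_trans (tau_le _ z0) iz.
rewrite normrM [`|z'^-1|]ger0_norm//.
by apply: le_trans lip; rewrite ler_piMr.
Qed.

(** Subtract the Volterra equations at [z] and [z']: the operator at [z] halves any bound on the
    difference, and the change of kernel costs [2 * |z - z'|] by [tau_lip], against a solution
    bounded by 2. *)
Lemma jost_lip q z z' x : intg `[0, 1] q -> large q z -> large q z' ->
  x \in `[0, 1] -> `|jost q z x - jost q z' x| <= 2 * (4 * l1norm q * `|z - z'|).
Proof.
move=> Iq lz lz'.
have z0 := large_gt0 lz; have z'0 := large_gt0 lz'.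
have Ij k : large q k -> intg `[0, 1] (fun s => q s * jost q k s).
  by move=> lk; apply: intgMc => //; exact: jost_cont.
apply: (@halving _ _ (fun x => x \in `[0, 1])
    (fun x => `|jost q z x - jost q z' x|) 4) => [t t01|b Hb t t01].
  rewrite (le_trans (ler_normB _ _))//.
  by have := jost_bound Iq lz t01; have := jost_bound Iq lz' t01; lra.
rewrite (jostE Iq lz t01) (jostE Iq lz' t01).
set h := jost q z'.
rewrite (_ : 1 + _ - (1 + _) = (volterra q z (jost q z) t - volterra q z h t) +
   (volterra q z h t - volterra q z' h t)); last by ring.
rewrite (le_trans (ler_normD _ _))// lerD//.
  rewrite (volterraB z0 (Ij _ lz) (Ij _ lz') t01).
  have I3 : intg `[0, 1] (fun s => q s * (jost q z s - h s)).
    apply: (@intg_ext _ _ (fun s => q s * jost q z s - q s * h s)) => //.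
      by move=> s _; ring.
    by apply: intgB => //; exact: Ij.
  apply: le_trans (volterra_bound Iq z0 I3 Hb t01) _.
  have b0 : 0 <= b := le_trans (normr_ge0 _) (Hb _ t01).
  rewrite mulrC ler_wpM2l// ler_pdivrMr// ler_pdivlMl//.
  exact: large2.
move: (t01); rewrite in_itv/= => /andP[t0 t1].
rewrite /volterra -RintegralB//; [|apply: intg_volterra => //; exact: Ij..].
have Iq1 : intg `[0, 1] (fun s => `|q s|) by exact: integrable_norm.
have Iqt := intgS (measurable_itv _) (measurable_itv _) (sub01 t1) Iq1.
apply: le_trans (norm_Rint_le (g := fun s => 4 * `|z - z'| * `|q s|) _ _ _ _) _ => //.
- by apply: intgB => //; apply: intg_volterra => //; exact: Ij.
- exact: intgZl.
- move=> s st; have s01 := sub01 t1 st; move: st; rewrite /= in_itv/= => /andP[s0 st].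
  rewrite -mulrBl normrM [`|q s * _|]normrM.
  have hb := jost_bound Iq lz' s01.
  have tl : `|tau z (t - s) - tau z' (t - s)| <= 2 * `|z - z'|.
    by apply: tau_lip; move: lz lz' => /andP[? _] /andP[? _]; lra.
  have := ler_pM (normr_ge0 _) (normr_ge0 _) tl hb.
  move=> /(ler_wpM2r (normr_ge0 (q s))).
  by rewrite -/h; lra.
rewrite RintegralZl// (_ : 4 * l1norm q * `|z - z'| = 4 * `|z - z'| * l1norm q); last by ring.
by rewrite ler_wpM2l// ?mulr_ge0//; apply: Rint_le_subset => //; exact: sub01.
Qed.

Lemma norm_squeeze (u : nat -> R) (l : R) (v : nat -> R) :
  (forall n, `|u n - l| <= v n) -> v n @[n --> \oo] --> 0 -> u n @[n --> \oo] --> l.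
Proof.
move=> uv v0; apply/cvgrPdist_lt => e e0.
near=> n; rewrite distrC (le_lt_trans (uv n))//.
rewrite (le_lt_trans (ler_norm _))//.
by near: n; apply: cvgr0_norm_lt.
Unshelve. all: by end_near. Qed.

Lemma dist_cvg0 (u : nat -> R) (l : R) : u n @[n --> \oo] --> l ->
  `|u n - l| @[n --> \oo] --> 0.
Proof.
move=> ul; rewrite -(normr0 R) -(subrr l); apply: cvg_norm.
by apply: cvgB => //; exact: cvg_cst.
Qed.

Lemma jost_cvg q (zn : nat -> R) z x : intg `[0, 1] q -> (forall n, large q (zn n)) ->
  large q z -> x \in `[0, 1] -> zn n @[n --> \oo] --> z ->
  jost q (zn n) x @[n --> \oo] --> jost q z x.
Proof.
move=> Iq lzn lz x01 cz.
apply: (norm_squeeze (fun n => jost_lip Iq (lzn n) lz x01)).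
rewrite -[X in _ --> X](mulr0 (2 * (4 * l1norm q))).
under eq_fun do rewrite mulrA.
by apply: cvgM; [exact: cvg_cst|exact: dist_cvg0].
Qed.

Lemma intg_jost_product q1 q2 z : intg `[0, 1] q1 -> intg `[0, 1] q2 ->
  large q1 z -> large q2 z ->
  intg `[0, 1]
    (fun x => (q2 x - q1 x) * (expR (z * x) * (jost q1 z x * jost q2 z x))).
Proof.
move=> I1 I2 l1 l2; apply: intgMc; first exact: intgB.
apply: within_contM; first exact: ac_cont (ac_expR 0 1 z).
by apply: within_contM; exact: jost_cont.
Qed.

(** Extends the bound on [jost_product] from the parameters at which the transform of [a] is nonzero
    to their limits. The condition [zn n <= z + 1] only serves domination. *)
Lemma jost_product_cvg q1 q2 (zn : nat -> R) z :
  intg `[0, 1] q1 -> intg `[0, 1] q2 ->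
  (forall n, large q1 (zn n)) -> (forall n, large q2 (zn n)) ->
  large q1 z -> large q2 z -> (forall n, zn n <= z + 1) ->
  zn n @[n --> \oo] --> z ->
  jost_product q1 q2 (zn n) @[n --> \oo] --> jost_product q1 q2 z.
Proof.
move=> I1 I2 ln1 ln2 l1 l2 zn1 cz.
have [] // := @Rint_cvg R `[0, 1]
  (fun n x => (q2 x - q1 x) * (expR (zn n * x) * (jost q1 (zn n) x * jost q2 (zn n) x)))
  (fun x => (q2 x - q1 x) * (expR (z * x) * (jost q1 z x * jost q2 z x)))
  (fun x => `|q2 x - q1 x| * (expR (z + 1) * 4)) => //.
- by move=> n; apply: intg_measurable; exact: intg_jost_product.
- apply: (intgMr (M := expR (z + 1) * 4)) => //.
    by apply: integrable_norm; exact: intgB.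
  by move=> _ _; rewrite ger0_norm// mulr_ge0// expR_ge0.
- move=> x x01; apply: cvgM; first exact: cvg_cst.
  apply: cvgM; last by apply: cvgM; exact: jost_cvg.
  apply: (@cvg_comp _ _ _ (fun n => zn n * x) expR _ (nbhs (z * x))).
    by apply: cvgM => //; exact: cvg_cst.
  exact: continuous_expR.
- move=> n x x01; rewrite normrM ler_wpM2l// normrM ler_pM//.
    rewrite ger0_norm ?expR_ge0// ler_expR.
    move: x01; rewrite /= in_itv/= => /andP[x0 x1].
    have z0 : 0 <= zn n by rewrite ltW// (large_gt0 (ln1 n)).
    by rewrite (le_trans _ (zn1 n))// ler_piMr.
  rewrite normrM (_ : 4 = 2 * 2); last by ring.
  by rewrite ler_pM// jost_bound.
Qed.

End Continuity.

(** * Exponential sums under the Volterra equation *)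

Section ExponentialSums.
Context {R : realType}.
Local Notation mu := (@lebesgue_measure R).
Local Notation intg D f := (mu.-integrable D (EFin \o f)).
Implicit Types (q f h : R -> R) (x y z d s t : R).
Variables (m : nat) (zeta : 'I_m -> R) (gam : R).
Hypotheses (gam0 : 0 < gam) (gamz : forall j, gam <= zeta j).

(** The exponent [y] is kept apart from the point [x] at which solutions hidden in [c] are
    evaluated. Negative [y] matter too, because the kernels shift [y] to the left. *)
Definition expsum (c : 'I_m -> R) y : R := \sum_(j < m) c j * expR (zeta j * y).

Let z0 j : 0 < zeta j. Proof. exact: lt_le_trans (gamz j). Qed.

(** [tau z d * expR (z * y)] is the integral of [expR (z * s)] over [[y - d, y]]. The kernels thus
    integrate the whole sum over one window, whatever the cancellation between its terms. *)
Lemma expsum_tau (c : 'I_m -> R) (C y d : R) :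
  (forall y, y <= 1 -> `|expsum c y| <= C * expR (gam * y)) -> y <= 1 -> 0 <= d ->
  `|expsum (fun j => c j * tau (zeta j) d) y| <=
  C / gam * (expR (gam * y) - expR (gam * (y - d))).
Proof.
move=> cC y1 d0; have ydy : y - d <= y by rewrite gerBl.
have yin : y \in `[y - d, y] by rewrite in_itv/= ydy lexx.
have Iexp (a : R) : intg `[y - d, y] (fun s => a * expR (a * s)).
  by have [] := ac_expR (y - d) y a.
have expE (a : R) : expR (a * y) - expR (a * (y - d)) =
    \int[mu]_(s in `[y - d, y]) (a * expR (a * s)).
  by have [_ /(_ _ yin) ->] := ac_expR (y - d) y a; rewrite addrC addKr.
have gn : gam != 0 by rewrite gt_eqF.
have Ic j : intg `[y - d, y] (fun s => c j * expR (zeta j * s)).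
  have zn : zeta j != 0 by rewrite gt_eqF.
  apply: (@intg_ext _ _ (fun s => c j / zeta j * (zeta j * expR (zeta j * s)))) => //.
    by move=> s _; field.
  exact: intgZl.
have -> : expsum (fun j => c j * tau (zeta j) d) y =
    \int[mu]_(s in `[y - d, y]) expsum c s.
  rewrite Rint_sum//; apply: eq_bigr => j _.
  have zn : zeta j != 0 by rewrite gt_eqF.
  transitivity (c j / zeta j * \int[mu]_(s in `[y - d, y]) (zeta j * expR (zeta j * s))).
    rewrite -expE /tau (_ : zeta j * (y - d) = zeta j * y + - (zeta j * d)); last by ring.
    by rewrite expRD; field.
  by rewrite -RintegralZl//; apply: eq_Rintegral => s _; field.
rewrite expE -RintegralZl//; apply: norm_Rint_le => //.
- exact: intg_sum.
- exact: intgZl.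
- move=> s; rewrite /= in_itv/= => /andP[_ sy].
  apply: le_trans (cC _ (le_trans sy y1)) _.
  by rewrite le_eqVlt; apply/orP; left; apply/eqP; field.
Qed.

Lemma expsum_tau_le (c : 'I_m -> R) (C y d : R) : 0 <= C ->
  (forall y, y <= 1 -> `|expsum c y| <= C * expR (gam * y)) -> y <= 1 -> 0 <= d ->
  `|expsum (fun j => c j * tau (zeta j) d) y| <= C / gam * expR (gam * y).
Proof.
move=> C0 cC y1 d0; apply: le_trans (expsum_tau cC y1 d0) _.
by rewrite ler_wpM2l ?divr_ge0 ?(ltW gam0)// gerBl expR_ge0.
Qed.

(** For short windows the length [d] replaces the gain [1 / gam], through
    [1 - expR (- (gam * d)) <= gam * d]. *)
Lemma expsum_tau_lip (c : 'I_m -> R) (C y d : R) : 0 <= C ->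
  (forall y, y <= 1 -> `|expsum c y| <= C * expR (gam * y)) -> y <= 1 -> 0 <= d ->
  `|expsum (fun j => c j * tau (zeta j) d) y| <= C * d * expR gam.
Proof.
move=> C0 cC y1 d0; apply: le_trans (expsum_tau cC y1 d0) _.
have -> : expR (gam * (y - d)) = expR (gam * y) * expR (- (gam * d)).
  by rewrite -expRD; congr expR; ring.
have e1 := expR_ge1Dx (- (gam * d)).
have e2 : expR (gam * y) <= expR gam by rewrite ler_expR ler_piMr// ltW.
have e3 := expR_gt0 (gam * y).
rewrite -!mulrA ler_wpM2l// ler_pdivrMl//.
have gd : 0 <= gam * d by rewrite mulr_ge0// ltW.
have -> : gam * (d * expR gam) = (gam * d) * expR gam by ring.
nra.
Qed.

Section jost.
Variable q : R -> R.
Hypotheses (Iq : intg `[0, 1] q) (qgam : 2 * l1norm q <= gam).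
Hypothesis lq : forall j, large q (zeta j).
Local Notation j_ j := (jost q (zeta j)).

Let Ij j : intg `[0, 1] (fun s => q s * j_ j s).
Proof. by apply: intgMc => //; exact: jost_cont. Qed.

Lemma expsum_volterra (c : 'I_m -> R) x y : x \in `[0, 1] ->
  expsum (fun j => c j * volterra q (zeta j) (j_ j) x) y =
  \int[mu]_(s in `[0, x])
     (q s * expsum (fun j => c j * j_ j s * tau (zeta j) (x - s)) y).
Proof.
move=> x01; rewrite /expsum /volterra.
transitivity (\sum_(j < m) \int[mu]_(s in `[0, x])
   (c j * expR (zeta j * y) * (tau (zeta j) (x - s) * (q s * j_ j s)))).
  apply: eq_bigr => j _; rewrite RintegralZl//; first by rewrite mulrAC.
  exact: intg_volterra.
rewrite -Rint_sum//; last by move=> j; apply: intgZl => //; exact: intg_volterra.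
apply: eq_Rintegral => s _; rewrite mulr_sumr; apply: eq_bigr => j _; ring.
Qed.

Lemma expsum_intg (c : 'I_m -> R) x y : x \in `[0, 1] ->
  intg `[0, x] (fun s => q s * expsum (fun j => c j * j_ j s * tau (zeta j) (x - s)) y).
Proof.
move=> x01; apply: (@intg_ext _ _ (fun s => \sum_(j < m)
   (c j * expR (zeta j * y) * (tau (zeta j) (x - s) * (q s * j_ j s))))) => //.
  by move=> s _; rewrite mulr_sumr; apply: eq_bigr => j _; ring.
by apply: intg_sum => // j; apply: intgZl => //; exact: intg_volterra.
Qed.

(* An a priori bound is plain but depends on c; inserting the Volterra equation
   halves the excess of any bound over a multiple of S. *)
Lemma expsum_jost (c : 'I_m -> R) (S : R) : 0 <= S ->
  (forall y, y <= 1 -> `|expsum c y| <= S * expR (gam * y)) ->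
  forall x y, x \in `[0, 1] -> y <= 1 ->
  `|expsum (fun j => c j * j_ j x) y| <= 2 * S * expR (gam * y).
Proof.
move=> S0 cS x y x01 y1.
(* The bootstrap runs over pairs, since the Volterra integral moves [x] and the kernel moves [y];
   dividing by the weight makes the bound uniform in [y]. *)
pose D (u : R * R) := u.1 \in `[0, 1] /\ u.2 <= 1.
pose f (u : R * R) := `|expsum (fun j => c j * j_ j u.1) u.2| / expR (gam * u.2).
suff : f (x, y) <= 2 * S by rewrite /f/= ler_pdivrMr// expR_gt0.
apply: (@halving _ _ D f (\sum_(j < m) `|c j| * 2 * expR (zeta j - gam))) => //.
  move=> [{x01}x {y1}y] [/= x01 y1]; rewrite /f/= ler_pdivrMr ?expR_gt0//.
  rewrite mulr_suml; apply: le_trans (ler_norm_sum _ _ _) _.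
  apply: ler_sum => j _; rewrite !normrM -!mulrA ler_wpM2l//.
  apply: ler_pM => //; first exact: jost_bound.
  rewrite ger0_norm ?expR_ge0// -expRD ler_expR.
  by have := gamz j; nra.
move=> b Hb [{x01}x {y1}y] [/= x01 y1]; rewrite /f/= ler_pdivrMr ?expR_gt0//.
have {}Hb t w : t \in `[0, 1] -> w <= 1 ->
    `|expsum (fun j => c j * j_ j t) w| <= b * expR (gam * w).
  by move=> t01 w1; rewrite -ler_pdivrMr ?expR_gt0//; exact: (Hb (t, w)).
have b0 : 0 <= b.
  have := le_trans (normr_ge0 _) (Hb _ _ x01 y1).
  by rewrite pmulr_lge0// expR_gt0.
have -> : expsum (fun j => c j * j_ j x) y =
    expsum c y + expsum (fun j => c j * volterra q (zeta j) (j_ j) x) y.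
  rewrite /expsum -big_split; apply: eq_bigr => j _ /=.
  by rewrite jostE//; ring.
rewrite (le_trans (ler_normD _ _))// mulrDl addrC lerD ?cS//.
rewrite expsum_volterra//.
move: (x01); rewrite in_itv/= => /andP[x0 x1].
have Iq1 : intg `[0, 1] (fun s => `|q s|) by exact: integrable_norm.
have Iqx := intgS (measurable_itv _) (measurable_itv _) (sub01 x1) Iq1.
apply: le_trans (norm_Rint_le (g := fun s => b / gam * expR (gam * y) * `|q s|) _ _ _ _) _ => //.
- exact: expsum_intg.
- exact: intgZl.
- move=> s sx; have s01 := sub01 x1 sx; move: sx; rewrite /= in_itv/= => /andP[s0 sx].
  rewrite normrM mulrC ler_wpM2r// expsum_tau_le ?subr_ge0//.
  by move=> w w1; exact: Hb.
rewrite RintegralZl//.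
apply: (@le_trans _ _ (b / gam * expR (gam * y) * l1norm q)).
  rewrite ler_wpM2l ?mulr_ge0 ?invr_ge0 ?expR_ge0 ?(ltW gam0)//.
  by apply: Rint_le_subset => //; exact: sub01.
rewrite mulrAC ler_wpM2r ?expR_ge0// -mulrA ler_wpM2l//.
by rewrite ler_pdivrMl// ler_pdivlMr// mulrC.
Qed.

(** [tau z e * (1 - expR (- (z * d)))] is symmetric in [d] and [e]. With [e = x - s], the shift of
    [y] by [d] under the kernel [tau z (x - s)] becomes a shift by [x - s] under the kernel
    [tau z d]; both of its terms are [O(d)] by [expsum_tau_lip]. *)
Lemma expsum_volterra_lip (c : 'I_m -> R) (K : R) : 0 <= K ->
  (forall x y, x \in `[0, 1] -> y <= 1 ->
    `|expsum (fun j => c j * j_ j x) y| <= K * expR (gam * y)) ->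
  forall x y d, x \in `[0, 1] -> y <= 1 -> 0 <= d ->
  `|expsum (fun j => c j * volterra q (zeta j) (j_ j) x) y -
    expsum (fun j => c j * volterra q (zeta j) (j_ j) x) (y - d)| <=
  2 * K * expR gam * l1norm q * d.
Proof.
move=> K0 cK x y d x01 y1 d0.
rewrite !expsum_volterra//.
move: (x01); rewrite in_itv/= => /andP[x0 x1].
rewrite -RintegralB//; [|exact: expsum_intg..].
have Iq1 : intg `[0, 1] (fun s => `|q s|) by exact: integrable_norm.
have Iqx := intgS (measurable_itv _) (measurable_itv _) (sub01 x1) Iq1.
apply: le_trans (norm_Rint_le (g := fun s => 2 * K * expR gam * d * `|q s|) _ _ _ _) _ => //.
- by apply: intgB => //; exact: expsum_intg.
- exact: intgZl.
- move=> s sx; have s01 := sub01 x1 sx; move: sx; rewrite /= in_itv/= => /andP[s0 sx].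
  have H w : w <= 1 ->
      `|expsum (fun j => c j * j_ j s * tau (zeta j) d) w| <= K * d * expR gam.
    by move=> w1; apply: expsum_tau_lip => // v v1; exact: cK.
  have y1' : y - (x - s) <= 1 by lra.
  have := H _ y1; have := H _ y1'; set u := expsum _ _; set v := expsum _ _ => Hu Hv.
  rewrite -mulrBr normrM mulrC ler_wpM2r//.
  rewrite (_ : expsum _ _ - expsum _ _ = v - u).
    rewrite (le_trans (ler_normB _ _))//; lra.
  rewrite /u /v /expsum -!sumrB; apply: eq_bigr => j _.
  have zn : zeta j != 0 by rewrite gt_eqF.
  rewrite /tau !mulrBr !expRD.
  by rewrite !expRN; field; rewrite zn !gt_eqF ?expR_gt0.
rewrite RintegralZl// (_ : 2 * K * expR gam * l1norm q * d =
  2 * K * expR gam * d * l1norm q); last by ring.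
rewrite ler_wpM2l ?mulr_ge0 ?expR_ge0//.
by apply: Rint_le_subset => //; exact: sub01.
Qed.

End jost.
End ExponentialSums.

(** * Sums weighted by products of two growing solutions *)

Section ProductSums.
Context {R : realType}.
Local Notation mu := (@lebesgue_measure R).
Local Notation intg D f := (mu.-integrable D (EFin \o f)).
Variables (m : nat) (zeta : 'I_m -> R) (gam : R) (q1 q2 : R -> R) (c : 'I_m -> R).
Hypotheses (gam0 : 0 < gam) (gamz : forall j, gam <= zeta j).
Hypotheses (I1 : intg `[0, 1] q1) (I2 : intg `[0, 1] q2).
Hypotheses (qgam1 : 2 * l1norm q1 <= gam) (qgam2 : 2 * l1norm q2 <= gam).
Hypotheses (lq1 : forall j, large q1 (zeta j)) (lq2 : forall j, large q2 (zeta j)).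
Hypothesis cE : forall y, y <= 1 -> `|expsum zeta c y| <= expR (gam * y).

Let c1 x y : x \in `[0, 1] -> y <= 1 ->
  `|expsum zeta (fun j => c j * jost q1 (zeta j) x) y| <= 2 * expR (gam * y).
Proof.
move=> x01 y1.
have := expsum_jost gam0 gamz I1 qgam1 lq1 ler01 _ x01 y1; rewrite mulr1.
by apply=> w w1; rewrite mul1r cE.
Qed.

(** The two factors have separate points because the Volterra integral for [q2] moves [t] while [x]
    stays fixed. *)
Let c2 x t y : x \in `[0, 1] -> t \in `[0, 1] -> y <= 1 ->
  `|expsum zeta (fun j => c j * jost q1 (zeta j) x * jost q2 (zeta j) t) y| <=
  4 * expR (gam * y).
Proof.
move=> x01 t01 y1.
have := expsum_jost gam0 gamz I2 qgam2 lq2 (ler0n _ 2) _ t01 y1.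
rewrite (_ : 2 * 2%:R = 4 :> R); last by ring.
by apply=> w w1; exact: c1.
Qed.

Lemma expsum_product x y : x \in `[0, 1] -> y <= 1 ->
  `|expsum zeta (fun j => c j * (jost q1 (zeta j) x * jost q2 (zeta j) x)) y| <=
  4 * expR (gam * y).
Proof.
move=> x01 y1; have := c2 x01 x01 y1.
by rewrite /expsum; under eq_bigr do rewrite -(mulrA (c _)).
Qed.

(** With [v_i] the growing solutions, [v_1 v_2 - 1 = (v_1 - 1) + v_1 (v_2 - 1)], and each [v_i - 1]
    is a Volterra integral. The 1 must be removed, as it carries the approximate step, whose slope
    is not bounded. *)
Lemma expsum_product_lip x y d : x \in `[0, 1] -> y <= 1 -> 0 <= d ->
  `|expsum zeta (fun j => c j * (jost q1 (zeta j) x * jost q2 (zeta j) x - 1)) y -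
    expsum zeta (fun j => c j * (jost q1 (zeta j) x * jost q2 (zeta j) x - 1)) (y - d)| <=
  2 * expR gam * (2 * l1norm q1 + 4 * l1norm q2) * d.
Proof.
move=> x01 y1 d0; set r := fun j => c j * _.
have rE w : expsum zeta r w =
    expsum zeta (fun j => c j * volterra q1 (zeta j) (jost q1 (zeta j)) x) w +
    expsum zeta (fun j => c j * jost q1 (zeta j) x *
      volterra q2 (zeta j) (jost q2 (zeta j)) x) w.
  rewrite /expsum -big_split; apply: eq_bigr => j _ /=; rewrite /r.
  have E1 := jostE I1 (lq1 j) x01; have E2 := jostE I2 (lq2 j) x01.
  rewrite [in LHS]E2 (_ : volterra q1 _ _ _ = jost q1 (zeta j) x - 1).
    by ring.
  by rewrite E1; ring.
rewrite !rE.
have L1 := expsum_volterra_lip gam0 gamz I1 lq1 (ler0n _ 2)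
  (fun x y => @c1 x y) x01 y1 d0.
have L2 := expsum_volterra_lip gam0 gamz I2 lq2 (ler0n _ 4)
  (fun t y t01 => @c2 x t y x01 t01) x01 y1 d0.
have tri (a b a' b' u v : R) : `|a - a'| <= u -> `|b - b'| <= v ->
    `|a + b - (a' + b')| <= u + v.
  move=> au bv; rewrite opprD addrACA.
  by rewrite (le_trans (ler_normD _ _))// lerD.
apply: le_trans (tri _ _ _ _ _ _ L1 L2) _.
by lra.
Qed.

End ProductSums.

(** * Polynomials approximating a step function *)

Section Threshold.
Context {R : realType}.
Implicit Types (r a : R) (n M : nat).

(* For r in [0, 1], tends as n grows to 1 if r > 1 / M and to 0 if r < 1 / M. *)
Definition threshold M n r : R := 1 - (1 - r ^+ n) ^+ (M ^ n).

Lemma threshold_ge0 M n r : 0 <= r -> r <= 1 -> 0 <= threshold M n r.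
Proof.
move=> r0 r1; rewrite subr_ge0 exprn_ile1 ?subr_ge0 ?exprn_ile1// lerBlDr.
by rewrite lerDl exprn_ge0.
Qed.

Lemma threshold_le1 M n r : r <= 1 -> 0 <= r -> threshold M n r <= 1.
Proof. by move=> r1 r0; rewrite gerBl exprn_ge0// subr_ge0 exprn_ile1. Qed.

Lemma bernoulli a (k : nat) : 0 <= a -> a <= 1 -> 1 - (1 - a) ^+ k <= k%:R * a.
Proof.
move=> a0 a1; elim: k => [|k IHk]; first by rewrite expr0 subrr mul0r.
have p0 : 0 <= (1 - a) ^+ k by rewrite exprn_ge0// subr_ge0.
have p1 : (1 - a) ^+ k <= 1 by rewrite exprn_ile1 ?subr_ge0// gerBl.
by rewrite exprS -natr1; nra.
Qed.

Lemma threshold_le M n r : 0 <= r -> r <= 1 -> threshold M n r <= (M%:R * r) ^+ n.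
Proof.
move=> r0 r1; apply: le_trans (bernoulli _ _ _) _.
- exact: exprn_ge0.
- exact: exprn_ile1.
- by rewrite natrX exprMn.
Qed.

(** Here [(1 - r^n)^(M^n) <= expR (- (M r)^n)], and [expR x >= 1 + x]. *)
Lemma threshold_ge M n r : 0 <= r -> r <= 1 ->
  1 - threshold M n r <= (1 + (M%:R * r) ^+ n)^-1.
Proof.
move=> r0 r1; rewrite opprB addrC subrK.
have a0 : 0 <= r ^+ n by exact: exprn_ge0.
have a1 : r ^+ n <= 1 by exact: exprn_ile1.
have t0 : 0 <= (M%:R * r) ^+ n by rewrite exprn_ge0// mulr_ge0.
apply: (@le_trans _ _ (expR (- ((M%:R * r) ^+ n)))).
  rewrite exprMn -natrX.
  rewrite -mulrN expRM_natl.
  apply: lerXn2r; rewrite ?nnegrE ?subr_ge0 ?expR_ge0//.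
  exact: expR_ge1Dx.
by rewrite expRN lef_pV2 ?posrE ?expR_gt0 ?expR_ge1Dx// ltr_wpDr.
Qed.

Lemma threshold_cvg0 M r : 0 <= r -> r <= 1 -> M%:R * r < 1 ->
  threshold M n r @[n --> \oo] --> (0 : R).
Proof.
move=> r0 r1 Mr; apply: (norm_squeeze (v := fun n => (M%:R * r) ^+ n)) => [n|].
  by rewrite subr0 ger0_norm ?threshold_le ?threshold_ge0.
by apply: cvg_expr; rewrite ger0_norm// mulr_ge0.
Qed.

Lemma threshold_cvg1 M r : 0 <= r -> r <= 1 -> 1 < M%:R * r ->
  threshold M n r @[n --> \oo] --> (1 : R).
Proof.
move=> r0 r1 Mr; apply: (norm_squeeze (v := fun n => (M%:R * r)^-1 ^+ n)) => [n|].
  rewrite distrC ger0_norm ?subr_ge0 ?threshold_le1//.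
  apply: le_trans (threshold_ge _ _ r0 r1) _.
  have p0 : 0 < (M%:R * r) ^+ n by rewrite exprn_gt0// (lt_trans _ Mr).
  by rewrite exprVn lef_pV2 ?posrE ?ltr_wpDl// lerDr.
apply: cvg_expr; rewrite ger0_norm ?invr_ge0 ?mulr_ge0// invf_lt1//.
exact: lt_trans Mr.
Qed.

(** There is no constant term: when [r] is an exponential, every exponent is a positive multiple of
    the same large number. *)
Lemma thresholdE M n r : threshold M n r =
  \sum_(j < M ^ n) (-1) ^+ j * 'C(M ^ n, j.+1)%:R * (r ^+ n) ^+ j.+1.
Proof.
rewrite /threshold exprBn big_ord_recl /= bin0 !expr1n expr0 !mul1r mulr1n.
rewrite opprD addNKr -sumrN; apply: eq_bigr => j _.
by rewrite /bump /= add1n expr1n mulr1 -mulr_natr exprS; ring.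
Qed.

End Threshold.

(** * Increments of the primitive of [q2 - q1] *)

Section Increment.
Context {R : realType}.
Local Notation mu := (@lebesgue_measure R).
Local Notation intg D f := (mu.-integrable D (EFin \o f)).
Implicit Types (q f h p : R -> R) (x y z s t : R).

Lemma Rint_cvg_ae (D : set (measurableTypeR R)) (F : nat -> R -> R) f g : measurable D ->
  (forall n, measurable_fun D (F n)) -> measurable_fun D f -> intg D g ->
  {ae mu, forall x, D x -> F n x @[n --> \oo] --> f x} ->
  (forall n x, D x -> `|F n x| <= g x) ->
  \int[mu]_(x in D) F n x @[n --> \oo] --> \int[mu]_(x in D) f x.
Proof.
move=> mD mF mf Ig Ff Fg.
have [| | |//| |If _ cv] := @dominated_convergence _ _ _ mu D mD
    (fun n => EFin \o F n) (EFin \o f) (EFin \o g).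
- by move=> n; exact/measurable_EFinP.
- exact/measurable_EFinP.
- apply: (@filterS _ _ (ae_filter_ringOfSetsType mu) _ _ _ Ff) => x Ffx Dx.
  by apply/cvg_EFin; [exact: nearW|exact: Ffx].
- by apply: aeW => x n Dx; rewrite /= lee_fin Fg.
apply: fine_cvg.
by rewrite /Rintegral fineK//; exact: integrable_fin_num.
Qed.

Lemma norm_le_lim (u w : nat -> R) (a b : R) : (forall n, `|u n| <= w n) ->
  u n @[n --> \oo] --> a -> w n @[n --> \oo] --> b -> `|a| <= b.
Proof.
move=> uw ua wb; rewrite -subr_ge0.
have cv : (w n - `|u n|) @[n --> \oo] --> b - `|a|.
  by apply: cvgB => //; exact: cvg_norm.
by apply: (cvgr_to_ge cv); apply: nearW => n; rewrite subr_ge0.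
Qed.

Lemma ln2_gt0 : 0 < ln 2 :> R.
Proof. by rewrite ln_gt0// ltr1n. Qed.

(* The coefficients of the expansion of threshold 2 n (ratio y), where
   ratio y > 1 / 2 exactly when y > 0. *)
Definition scale n : R := n%:R * ln 2.
Definition node n (j : 'I_(2 ^ n)) : R := j.+1%:R * scale n.
Definition coef n (j : 'I_(2 ^ n)) : R :=
  (-1) ^+ j * 'C(2 ^ n, j.+1)%:R * expR (- node j).
Definition ratio y : R := expR (ln 2 * (y - 1)).

Lemma ratio_ge0 y : 0 <= ratio y. Proof. exact: expR_ge0. Qed.

Lemma ratio_le1 y : y <= 1 -> ratio y <= 1.
Proof. by move=> y1; rewrite -expR0 ler_expR mulr_ge0_le0 ?subr_le0// ltW// ln2_gt0. Qed.

Lemma ratio2 y : 2 * ratio y = expR (ln 2 * y).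
Proof.
rewrite -[X in X * _](@lnK R 2) ?posrE// /ratio -expRD; congr expR; ring.
Qed.

Lemma expsum_coef n y : expsum (@node n) (@coef n) y = threshold 2 n (ratio y).
Proof.
rewrite thresholdE; apply: eq_bigr => j _; rewrite /coef /ratio.
rewrite -[LHS]mulrA -expRD -!expRM_natl; congr (_ * expR _); rewrite /node /scale; ring.
Qed.

(** The freedom in [g] is used twice: a fixed [g] gives constants independent of [n], while
    [g = scale n] gives sharp decay for negative [y]. *)
Lemma expsum_coef_le n (g : R) y : 0 <= g -> g <= scale n -> y <= 1 ->
  `|expsum (@node n) (@coef n) y| <= expR (g * y).
Proof.
move=> g0 gs y1; rewrite expsum_coef.
have r1 := ratio_le1 y1; have r0 := ratio_ge0 y.
rewrite ger0_norm ?threshold_ge0//; have [y0|y0] := leP 0 y.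
  apply: le_trans (threshold_le1 _ _ _ _) _ => //.
  by rewrite -expR0 ler_expR mulr_ge0.
apply: le_trans (threshold_le _ _ _ _) _ => //.
rewrite ratio2 -expRM_natl ler_expR mulrA -/(scale n).
by have := ler_wnM2r (ltW y0) gs.
Qed.

Lemma expR_sub1 (x : R) : expR x - 1 <= x * expR x.
Proof.
have := expR_ge1Dx (- x); rewrite expRN => H.
have e0 := expR_gt0 x.
have := ler_wpM2r (ltW e0) H.
by rewrite mulVf ?gt_eqF//; lra.
Qed.

(* Bounding j.+1 by 2 ^ j.+1, the absolute values add up to (1 + 2 a) ^ (2 ^ n) - 1,
   where 2 ^ n * a = expR (- (scale n * s)). *)
Lemma expsum_small n (I : 'I_(2 ^ n) -> R) s : (0 < n)%N -> 0 < s ->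
  (forall j, `|I j| <= 16 * node j) ->
  `|expsum (@node n) (fun j => coef j * I j) (- s)| <= (128 * expR 2 / s ^+ 2 / ln 2) / n%:R.
Proof.
move=> n0 s0 Ib.
have l0 := ln2_gt0.
have th0 : 0 < scale n by rewrite mulr_gt0 ?ltr0n.
set a := expR (- (scale n * (1 + s))).
have a0 : 0 <= a by exact: expR_ge0.
have Ea j : expR (- (@node n j)) * expR (@node n j * - s) = a ^+ j.+1.
  rewrite -expRD /a -expRM_natl; congr expR; rewrite /node; ring.
have E2 : (2 ^ n)%:R = expR (scale n) :> R.
  by rewrite natrX -[X in X ^+ _](@lnK R 2) ?posrE// -expRM_natl.
apply: (@le_trans _ _ (\sum_(j < 2 ^ n) 16 * scale n * ((2 * a) ^+ j.+1 *+ 'C(2 ^ n, j.+1)))).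
  apply: le_trans (ler_norm_sum _ _ _) _; apply: ler_sum => j _.
  rewrite (_ : coef j * I j * _ = (-1) ^+ j * ('C(2 ^ n, j.+1)%:R * (I j * a ^+ j.+1))); last first.
    by rewrite -Ea /coef; ring.
  rewrite normrM normrX normrN normr1 expr1n mul1r normrM ger0_norm//.
  rewrite -[X in _ <= _ * X]mulr_natl mulrCA ler_wpM2l//.
  rewrite normrM (ger0_norm (exprn_ge0 _ a0)) exprMn mulrA.
  rewrite ler_wpM2r ?exprn_ge0//; apply: le_trans (Ib j) _.
  rewrite -mulrA ler_wpM2l// /node mulrC ler_wpM2l ?(ltW th0)//.
  by rewrite -natrX ler_nat ltnW// ltn_expl.
rewrite -mulr_sumr.
have -> : \sum_(j < 2 ^ n) (2 * a) ^+ j.+1 *+ 'C(2 ^ n, j.+1) = (1 + 2 * a) ^+ (2 ^ n) - 1.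
  rewrite exprDn big_ord_recl /= bin0 expr1n expr0 mul1r mulr1n addrC addKr.
  by apply: eq_bigr => j _; rewrite /bump /= add1n expr1n mul1r.
have e1 : (1 + 2 * a) ^+ (2 ^ n) <= expR (2 * expR (- (scale n * s))).
  have -> : expR (2 * expR (- (scale n * s))) = expR (2 * a) ^+ (2 ^ n).
    rewrite -expRM_natl E2 /a; congr expR; rewrite mulrCA; congr (_ * _).
    by rewrite -expRD; congr expR; ring.
  apply: lerXn2r; rewrite ?nnegrE ?expR_ge0 ?addr_ge0 ?mulr_ge0//.
  exact: expR_ge1Dx.
set e := expR (- (scale n * s)) in e1.
have e0 : 0 < e by exact: expR_gt0.
have ele1 : e <= 1 by rewrite /e -expR0 ler_expR oppr_le0 mulr_ge0// ltW.
have e2 : (1 + 2 * a) ^+ (2 ^ n) - 1 <= 2 * e * expR 2.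
  apply: (@le_trans _ _ (expR (2 * e) - 1)); first by rewrite lerB.
  apply: le_trans (expR_sub1 _) _; rewrite ler_wpM2l// ?mulr_ge0 ?(ltW e0)//.
  by rewrite ler_expR; lra.
(* A square suffices: one power of [scale n] compensates the factor coming from the bound on [I],
   the other leaves [1 / n]. *)
have e3 : e <= 4 / (scale n * s) ^+ 2.
  have x0 : 0 < scale n * s by rewrite mulr_gt0.
  rewrite /e expRN -[4 / _]invf_div lef_pV2 ?posrE ?expR_gt0 ?divr_gt0 ?exprn_gt0//.
  have -> : expR (scale n * s) = expR (scale n * s / 2) ^+ 2.
    by rewrite -expRM_natl; congr expR; field.
  have := expR_ge1Dx (scale n * s / 2); nra.
apply: (@le_trans _ _ (16 * scale n * (2 * (4 / (scale n * s) ^+ 2) * expR 2))).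
  rewrite ler_wpM2l ?mulr_ge0 ?(ltW th0) ?(ltW l0)//; apply: le_trans e2 _.
  by rewrite ler_wpM2r ?expR_ge0// ler_wpM2l.
rewrite le_eqVlt; apply/orP; left; apply/eqP; rewrite /scale; field.
by rewrite !gt_eqF// ltr0n.
Qed.

Lemma measurable_b2R (b : R -> bool) : measurable_fun setT b ->
  measurable_fun setT (fun x => (b x)%:R : R).
Proof.
move=> mb; exact: (@measurableT_comp _ _ _ _ _ _ (fun b : bool => b%:R : R)).
Qed.

Lemma ae_neq s : {ae mu, forall x, x != s}.
Proof.
exists [set s]; split; first exact: measurable_set1.
  exact: lebesgue_measure_set1.
by move=> x /= /negP; rewrite negbK => /eqP.
Qed.

Section increment.
Variables (q1 q2 : R -> R) (Z : R).
Hypotheses (Z0 : 0 <= Z) (I1 : intg `[0, 1] q1) (I2 : intg `[0, 1] q2).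
Hypothesis H : forall z, Z <= z -> large q1 z -> large q2 z -> `|jost_product q1 q2 z| <= 16 * z.
Let p x := q2 x - q1 x.
Let Ip : intg `[0, 1] p. Proof. exact: intgB. Qed.
(** Once [scale n >= g0], every node exceeds [Z] and is [large] for both potentials. [g0] also
    serves as the weight [gam], which keeps [C] independent of [n]. *)
Let g0 : R := 2 + 16 * l1norm q1 + 16 * l1norm q2 + Z.
Let C : R := 2 * expR g0 * (2 * l1norm q1 + 4 * l1norm q2).

Let psum n s x := p x * expsum (@node n)
  (fun j => coef j * (jost q1 (node j) x * jost q2 (node j) x)) (x - s).

Let large_node n j : g0 <= scale n ->
  [/\ large q1 (@node n j), large q2 (@node n j) & Z <= @node n j].
Proof.
move=> gs; have l1 := l1norm_ge0 q1; have l2 := l1norm_ge0 q2.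
have : scale n <= node j.
  rewrite /node ler_peMl ?ler1n// (le_trans _ gs)// /g0; move: Z0; lra.
rewrite /large; move: gs Z0; rewrite /g0 => ? ? ?.
by split; [apply/andP; split; lra..|lra].
Qed.

Let psumE n s x : psum n s x = \sum_(j < 2 ^ n) coef j * expR (node j * - s) *
  (p x * (expR (node j * x) * (jost q1 (node j) x * jost q2 (node j) x))).
Proof.
rewrite /psum /expsum mulr_sumr; apply: eq_bigr => j _.
by rewrite mulrDr expRD; ring.
Qed.

Let Ipsum n s : g0 <= scale n -> intg `[0, 1] (psum n s).
Proof.
move=> gs; have -> : psum n s = fun x => \sum_(j < 2 ^ n) coef j * expR (node j * - s) *
    (p x * (expR (node j * x) * (jost q1 (node j) x * jost q2 (node j) x))).
  by apply/funext => x; exact: psumE.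
apply: intg_sum => // j; apply: intgZl => //.
by have [? ? _] := large_node j gs; exact: intg_jost_product.
Qed.

Let Rint_psum n s : g0 <= scale n -> \int[mu]_(x in `[0, 1]) psum n s x =
  expsum (@node n) (fun j => coef j * jost_product q1 q2 (node j)) (- s).
Proof.
move=> gs; transitivity (\int[mu]_(x in `[0, 1]) (\sum_(j < 2 ^ n)
    coef j * expR (node j * - s) *
    (p x * (expR (node j * x) * (jost q1 (node j) x * jost q2 (node j) x))))).
  by apply: eq_Rintegral => x _; rewrite psumE.
have Ij (j : 'I_(2 ^ n)) : intg `[0, 1] (fun x => p x * (expR (node j * x) *
    (jost q1 (node j) x * jost q2 (node j) x))).
  by have [? ? _] := large_node j gs; exact: intg_jost_product.
rewrite Rint_sum//; last by move=> j; apply: intgZl.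
by apply: eq_bigr => j _; rewrite RintegralZl// mulrAC.
Qed.

(** [U n] approximates [p] times the indicator of []s, s'[]. It differs from [psum] at [s] minus
    [psum] at [s'], whose integrals are [O(1 / n)], by [p x] times an increment of the sum with
    coefficients [v_1 v_2 - 1]. To the right of [s] that increment is Lipschitz in [s' - s]; to the
    left it decays exponentially. Only the tail of [|p|] beyond [s] survives, as a Gronwall argument
    started at 1 requires. *)
Lemma increment_bound s s' : 0 < s -> s < s' -> s' <= 1 ->
  `|\int[mu]_(x in `[0, 1]) (p x * ((s < x)%R && (x < s')%R)%:R)| <=
  C * (s' - s) * \int[mu]_(x in `[s, 1]) `|p x|.
Proof.
move=> s0 ss' s'1.
have g00 : 2 <= g0.
  by rewrite /g0; have := l1norm_ge0 q1; have := l1norm_ge0 q2; move: Z0; lra.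
have C0 : 0 <= C.
  by rewrite /C !mulr_ge0 ?expR_ge0// addr_ge0// mulr_ge0// l1norm_ge0.
have l0 := ln2_gt0.
have [N gN] : exists N, g0 <= scale N.
  exists (Num.bound (g0 / ln 2)); rewrite /scale -ler_pdivrMr//.
  by apply: ltW; apply: archi_boundP; rewrite divr_ge0 ?(ltW l0)//; lra.
(* The shift makes [g0 <= scale (k n)] and [0 < k n] hold for every [n]. *)
pose k n := (n + N.+1)%N.
have gk n : g0 <= scale (k n).
  by apply: le_trans gN _; rewrite /scale ler_wpM2r ?(ltW l0)// ler_nat /k addnS leqW// leq_addl.
pose E n t x := threshold 2 (k n) (ratio (x - t)).
have mE n t : measurable_fun setT (E n t).
  apply: measurable_funB => //; apply: measurable_funX; apply: measurable_funB => //.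
  apply: measurable_funX; apply: (measurableT_comp (f := expR)) => //.
  by apply: measurable_funM => //; apply: measurable_funB => //; exact: measurable_funB.
have x1 t x : 0 < t -> x \in `[0, 1] -> x - t <= 1.
  by rewrite in_itv/= => t0 /andP[_ x1]; lra.
have E01 n t x : 0 < t -> x \in `[0, 1] -> `|E n t x| <= 1.
  move=> t0 x01; have := x1 _ _ t0 x01 => y1.
  by rewrite ger0_norm ?threshold_le1 ?threshold_ge0 ?ratio_le1 ?ratio_ge0.
have s'0 : 0 < s' by exact: lt_trans ss'.
pose U n x := p x * (E n s x - E n s' x).
pose B n x := C * (s' - s) * (s <= x)%R%:R + 10 * expR (scale (k n) * (x - s)) * (x < s)%R%:R.
have IU n : intg `[0, 1] (U n).
  apply: (intgMr (M := 2)) => //.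
    by apply: measurable_funTS; apply: measurable_funB; exact: mE.
  move=> x x01; rewrite (le_trans (ler_normB _ _))//.
  by have := E01 n _ _ s0 x01; have := E01 n _ _ s'0 x01; lra.
have B0 n x : 0 <= B n x.
  have C1 : 0 <= C * (s' - s) by rewrite mulr_ge0// subr_ge0 ltW.
  apply: addr_ge0; first exact: mulr_ge0.
  by rewrite !mulr_ge0// expR_ge0.
have ek n x : x < s -> expR (scale (k n) * (x - s)) <= 1.
  move=> xs; rewrite -expR0 ler_expR mulr_ge0_le0 ?subr_le0 ?(ltW xs)//.
  by apply: le_trans (gk n); lra.
have Bx n x : B n x <= C * (s' - s) + 10.
  have C1 : 0 <= C * (s' - s) by rewrite mulr_ge0// subr_ge0 ltW.
  rewrite /B; have [sx|xs] := leP s x; rewrite /= ?mulr1 ?mulr0 ?addr0 ?add0r.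
    by lra.
  by have := ek n _ xs; lra.
have mB n : measurable_fun setT (B n).
  apply: measurable_funD; apply: measurable_funM => //.
  - by apply: measurable_b2R; exact: measurable_fun_ler.
  - apply: measurable_funM => //; apply: (measurableT_comp (f := expR)) => //.
    by apply: measurable_funM => //; exact: measurable_funB.
  - by apply: measurable_b2R; exact: measurable_fun_ltr.
have IB n : intg `[0, 1] (fun x => `|p x| * B n x).
  apply: (intgMr (M := C * (s' - s) + 10)) => //.
  - exact: integrable_norm.
  - by apply: measurable_funTS; exact: mB.
  - by move=> x _; rewrite ger0_norm.
pose K : R := 128 * expR 2 / ln 2.
have step n : `|\int[mu]_(x in `[0, 1]) U n x| <=
    (K / s ^+ 2 / (k n)%:R + K / s' ^+ 2 / (k n)%:R) +
    \int[mu]_(x in `[0, 1]) (`|p x| * B n x).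
  have k0 : (0 < k n)%N by rewrite /k addnS.
  pose V x := psum (k n) s x - psum (k n) s' x - U n x.
  have IV : intg `[0, 1] V by apply: intgB => //; apply: intgB => //; exact: Ipsum.
  have -> : \int[mu]_(x in `[0, 1]) U n x =
      \int[mu]_(x in `[0, 1]) psum (k n) s x - \int[mu]_(x in `[0, 1]) psum (k n) s' x
      - \int[mu]_(x in `[0, 1]) V x.
    have Js := Ipsum s (gk n); have Js' := Ipsum s' (gk n).
    have Jd := intgB (measurable_itv _) Js Js'.
    rewrite -RintegralB// -RintegralB//.
    by apply: eq_Rintegral => x _; rewrite /V; ring.
  rewrite (le_trans (ler_normB _ _))// lerD//.
    rewrite (le_trans (ler_normB _ _))// !Rint_psum// lerD//.
    - apply: le_trans (expsum_small k0 s0 _) _ => [j|].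
        by have [? ? ?] := large_node j (gk n); exact: H.
      by rewrite /K (mulrAC (128 * expR 2)) lexx.
    - apply: le_trans (expsum_small k0 s'0 _) _ => [j|].
        by have [? ? ?] := large_node j (gk n); exact: H.
      by rewrite /K (mulrAC (128 * expR 2)) lexx.
  apply: norm_Rint_le => // x x01.
  have y1 := x1 _ _ s0 x01; have y1' := x1 _ _ s'0 x01.
  pose r w := expsum (@node (k n)) (fun j => coef j *
    (jost q1 (node j) x * jost q2 (node j) x - 1)) w.
  have rE w : r w = expsum (@node (k n)) (fun j => coef j *
      (jost q1 (node j) x * jost q2 (node j) x)) w - threshold 2 (k n) (ratio w).
    rewrite -expsum_coef /r /expsum -sumrB; apply: eq_bigr => j _; ring.
  have -> : V x = p x * (r (x - s) - r (x - s')).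
    by rewrite /V /U /E /psum !rE; ring.
  rewrite normrM ler_wpM2l// /B.
  have gz j : scale (k n) <= @node (k n) j.
    rewrite /node ler_peMl ?ler1n//; apply: le_trans (gk n); lra.
  have gz0 j : g0 <= @node (k n) j by apply: le_trans (gk n) (gz j).
  have l1 := l1norm_ge0 q1; have l2 := l1norm_ge0 q2.
  have lq1 j : large q1 (@node (k n) j) by have [] := large_node j (gk n).
  have lq2 j : large q2 (@node (k n) j) by have [] := large_node j (gk n).
  have [sx|xs] := leP s x; rewrite /= ?mulr1 ?mulr0 ?addr0 ?add0r.
    rewrite (_ : x - s' = x - s - (s' - s)); last by ring.
    apply: (@expsum_product_lip _ _ _ g0) => //; last by rewrite subr_ge0 ltW.
    - by lra.
    - by rewrite /g0; move: Z0; lra.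
    - by rewrite /g0; move: Z0; lra.
    - by move=> w w1; apply: expsum_coef_le => //; lra.
  have sk0 : 0 < scale (k n) by apply: lt_le_trans (gk n); lra.
  (* With weight [scale (k n)]: 4 from [expsum_product] and 1 from the threshold itself. The two
     points [x - s] and [x - s'] give the 10 in [B]. *)
  have P w : w <= x - s -> `|r w| <= 5 * expR (scale (k n) * (x - s)).
    move=> ws; have w1 : w <= 1 by lra.
    have ew : expR (scale (k n) * w) <= expR (scale (k n) * (x - s)).
      by rewrite ler_expR ler_wpM2l// ltW.
    have cE y : y <= 1 -> `|expsum (@node (k n)) (@coef (k n)) y| <=
        expR (scale (k n) * y).
      by move=> yle; apply: expsum_coef_le => //; exact: ltW.
    have qs1 : 2 * l1norm q1 <= scale (k n) by apply: le_trans (gk n); rewrite /g0; move: Z0; lra.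
    have qs2 : 2 * l1norm q2 <= scale (k n) by apply: le_trans (gk n); rewrite /g0; move: Z0; lra.
    have B1 := expsum_product sk0 gz I1 I2 qs1 qs2 lq1 lq2 cE x01 w1.
    have B2 := cE _ w1; rewrite expsum_coef in B2.
    by rewrite rE (le_trans (ler_normB _ _))//; lra.
  rewrite (le_trans (ler_normB _ _))//.
  have := P _ (lexx _); have : x - s' <= x - s by lra.
  by move=> /P; lra.
have cU : \int[mu]_(x in `[0, 1]) U n x @[n --> \oo] -->
    \int[mu]_(x in `[0, 1]) (p x * ((s < x)%R && (x < s')%R)%:R).
  apply: (Rint_cvg_ae (g := fun x => `|p x| * 2)) => //.
  - by move=> n; exact: intg_measurable.
  - apply: measurable_funM; first exact: intg_measurable.
    apply: measurable_funTS; apply: measurable_b2R.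
    by apply: measurable_and; exact: measurable_fun_ltr.
  - apply: (intgMr (M := 2)) => //; first exact: integrable_norm.
    by move=> _ _; rewrite ger0_norm.
  (* At [x = s] the threshold tends to [1 - 1 / e] instead, so the two endpoints are left out as a
     null set. *)
  - have F := ae_filter_ringOfSetsType mu.
    apply: (@filterS2 _ _ F _ _ _ _ (ae_neq s) (ae_neq s')) => x xs xs' x01.
    have y1 := x1 _ _ s0 x01; have y1' := x1 _ _ s'0 x01.
    have cE (t : R) : t != x -> x - t <= 1 -> E n t x @[n --> \oo] --> ((t < x)%R%:R : R).
      move=> tx xt1; apply: (@cvg_comp _ _ _ k (fun n => threshold 2 n (ratio (x - t)))
        _ \oo); first exact: cvg_addnr.
      have [xt|xt|xt] := ltgtP t x; last by rewrite xt eqxx in tx.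
      + apply: threshold_cvg1; rewrite ?ratio_ge0 ?ratio_le1// ratio2.
        have p0 : 0 < ln 2 * (x - t) by rewrite mulr_gt0 ?subr_gt0 ?ln2_gt0.
        by rewrite -[X in X < _](@expR0 R) ltr_expR.
      + apply: threshold_cvg0; rewrite ?ratio_ge0 ?ratio_le1// ratio2.
        have p0 : ln 2 * (x - t) < 0 by rewrite pmulr_rlt0 ?subr_lt0 ?ln2_gt0.
        by rewrite -[X in _ < X](@expR0 R) ltr_expR.
    apply: cvgM; first exact: cvg_cst.
    have -> : ((s < x)%R && (x < s')%R)%:R = (s < x)%R%:R - (s' < x)%R%:R :> R.
      have [x1s|x1s|E1] := ltgtP s x; have [x2s|x2s|E2] := ltgtP s' x => /=;
        rewrite ?subrr ?subr0//; by [move: E2 xs' => -> /eqP| move: E1 xs => -> /eqP|lra].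
    by apply: cvgB; apply: cE; rewrite // eq_sym.
  - move=> n x x01; rewrite normrM ler_wpM2l// (le_trans (ler_normB _ _))//.
    by have := E01 n _ _ s0 x01; have := E01 n _ _ s'0 x01; lra.
have cB : \int[mu]_(x in `[0, 1]) (`|p x| * B n x) @[n --> \oo] -->
    \int[mu]_(x in `[0, 1]) (`|p x| * (C * (s' - s) * (s <= x)%R%:R)).
  have [] // := @Rint_cvg R `[0, 1] (fun n x => `|p x| * B n x)
    (fun x => `|p x| * (C * (s' - s) * (s <= x)%R%:R))
    (fun x => `|p x| * (C * (s' - s) + 10)) => //.
  - by move=> n; exact: intg_measurable.
  - apply: (intgMr (M := C * (s' - s) + 10)) => //; first exact: integrable_norm.
    by move=> x _; rewrite ger0_norm// (le_trans (B0 0%N x)).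
  - move=> x x01; apply: cvgM; first exact: cvg_cst.
    have [sx|xs] := leP s x.
      apply: (norm_squeeze (v := cst 0)) => [n|]; last exact: cvg_cst.
      by rewrite /B sx (le_gtF sx) /= mulr0 addr0 subrr normr0.
    apply: (norm_squeeze (v := fun n => 10 * expR (ln 2 * (x - s)) ^+ k n)) => [n|].
      rewrite /B (lt_geF xs) xs /= !mulr0 add0r subr0 mulr1 -expRM_natl mulrA.
      by rewrite ger0_norm// mulr_ge0// expR_ge0.
    rewrite -(mulr0 (10 : R)); apply: cvgM; first exact: cvg_cst.
    apply: (@cvg_comp _ _ _ k (fun n => expR (ln 2 * (x - s)) ^+ n) _ \oo).
      exact: cvg_addnr.
    have p0 : ln 2 * (x - s) < 0 by rewrite pmulr_rlt0 ?subr_lt0 ?ln2_gt0.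
    apply: cvg_expr; rewrite ger0_norm ?expR_ge0//.
    by rewrite -[X in _ < X](@expR0 R) ltr_expR.
  - by move=> n x _; rewrite normrM normr_id ler_wpM2l// ger0_norm.
have cvk (t : R) : (t / (k n)%:R : R) @[n --> \oo] --> 0.
  rewrite -(mulr0 t); apply: cvgM; first exact: cvg_cst.
  apply: (norm_squeeze (v := harmonic)); last exact: cvg_harmonic.
  move=> n; have k0 : (0 < k n)%N by rewrite /k addnS.
  rewrite subr0 ger0_norm ?invr_ge0//; rewrite lef_pV2 ?posrE ?ltr0n//.
  by rewrite ler_nat /k addnS ltnS leq_addr.
have cW := cvgD (cvgD (cvk (K / s ^+ 2)) (cvk (K / s' ^+ 2))) cB.
apply: le_trans (norm_le_lim step cU (cW _ _)) _; rewrite !add0r.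
 rewrite le_eqVlt; apply/orP; left; apply/eqP.
under eq_Rintegral do rewrite mulrCA.
rewrite RintegralZl//; last first.
  apply: (intgMr (M := 1)) => //; first exact: integrable_norm.
    by apply: measurable_funTS; apply: measurable_b2R; exact: measurable_fun_ler.
  by move=> x _; case: (s <= x); rewrite /= ?normr1 ?normr0.
congr (_ * _); apply: Rint_indic => x /=; rewrite !in_itv/=.
  by move=> /andP[/(lt_le_trans s0)/ltW -> ->].
by move=> /andP[_ ->]; rewrite andbT.
Qed.

End increment.
End Increment.

(** * Lebesgue differentiation in the form of a pointwise bound *)

Section LebesguePoint.
Context {R : realType}.
Local Notation mu := (@lebesgue_measure R).
Local Notation intg D f := (mu.-integrable D (EFin \o f)).

(** One null set, off which the primitive has derivative [f], serves all [B] and [d]. Hence [B] may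
    depend on [x]. *)
Lemma ae_le_of_increments (f : R -> R) : intg setT f -> locally_integrable setT f ->
  {ae mu, forall x, forall B d : R, 0 < d ->
    (forall y, x < y -> y < x + d -> `|\int[mu]_(t in `]x, y]) f t| <= B * (y - x)) ->
    `|f x| <= B}.
Proof.
move=> IfT lf.
have If (D : set (measurableTypeR R)) : measurable D -> intg D f.
  by move=> mD; exact: intgS IfT.
pose F (x : R) : R := \int[mu]_(t in `]-oo, x]) f t.
have FF := FTC1Ny (fun y => If _ (measurable_itv `]-oo, y])) lf.
suff key (x : R) : derivable F x 1 -> F^`()%classic x = f x ->
    forall B d : R, 0 < d ->
    (forall y, x < y -> y < x + d -> `|\int[mu]_(t in `]x, y]) f t| <= B * (y - x)) ->
    `|f x| <= B.
  by apply: (@filterS _ _ (ae_filter_ringOfSetsType mu) _ _ _ FF) => x [dF F']; exact: key.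
clear FF => dF F' B d d0 HB.
suff : `|F^`()%classic x| <= B by rewrite F'.
have cv : h^-1 *: (F (h + x) - F x) @[h --> 0^'+] --> F^`()%classic x.
  rewrite derive1E; apply: cvg_dnbhs_at_right.
  apply: cvg_trans dF; apply: near_eq_cvg; near=> h.
  by rewrite /= /GRing.scale /= mulr1.
have cvn : `|h^-1 *: (F (h + x) - F x)| @[h --> 0^'+] --> `|F^`()%classic x|.
  exact: cvg_norm cv.
apply: (cvgr_to_le cvn); near=> h.
have h0 : 0 < h by near: h; exact: nbhs_right_gt.
have hd : h < d by near: h; apply: nbhs_right_lt.
rewrite normrM normfV (gtr0_norm h0) ler_pdivrMl//.
rewrite /F Rintegral_itvB ?bnd_simp ?lerDr ?(ltW h0)//; last exact: If.
apply: le_trans (HB _ _ _) _; rewrite ?ltrDr//; first by rewrite addrC ltrD2l.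
by rewrite addrK mulrC.
Unshelve. all: by end_near. Qed.

End LebesguePoint.

(** * A backward Gronwall argument *)

Section Vanishing.
Context {R : realType}.
Local Notation mu := (@lebesgue_measure R).
Local Notation intg D f := (mu.-integrable D (EFin \o f)).
Variables (p : R -> R) (C : R).
Hypotheses (Ip : intg `[0, 1] p) (C0 : 0 <= C).
Let P (s : R) := \int[mu]_(x in `[s, 1]) `|p x|.
Hypothesis H : forall s s', 0 < s -> s < s' -> s' <= 1 ->
  `|\int[mu]_(x in `[0, 1]) (p x * ((s < x)%R && (x < s')%R)%:R)| <= C * (s' - s) * P s.

Let Iabs : intg `[0, 1] (fun x => `|p x|). Proof. exact: integrable_norm. Qed.

Let sub1 s : 0 <= s -> (`[s, 1]%classic : set R) `<=` `[0, 1]%classic.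
Proof. by move=> s0 x /=; rewrite !in_itv/= => /andP[/(le_trans s0) -> ->]. Qed.

Let P_ge0 s : 0 <= P s. Proof. by apply: Rintegral_ge0 => x _; exact: normr_ge0. Qed.

Let P_anti s t : 0 <= s -> s <= t -> P t <= P s.
Proof.
move=> s0 st; apply: Rint_le_subset => //.
- by move=> x /=; rewrite !in_itv/= => /andP[/(le_trans st) -> ->].
- exact: intgS (sub1 s0) Iabs.
Qed.

Lemma ae_le_tail : {ae mu, forall x, 0 < x -> x < 1 -> `|p x| <= C * P x}.
Proof.
pose f := p \_ `[0, 1].
have IfT : intg setT f.
  have mI : measurable (`[0, 1]%classic : set (measurableTypeR R)) by [].
  by rewrite /f -restrict_EFin; apply/(integrable_mkcond _ mI).
have := ae_le_of_increments IfT
  (integrable_locally_restrict (measurable_itv `[0, 1]) Ip).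
apply: (@filterS _ _ (ae_filter_ringOfSetsType mu)) => x Hx x0 x1.
have fx : f x = p x by rewrite /f patchE mem_set//= in_itv/= !ltW.
rewrite -fx; apply: (Hx _ (1 - x)); first by rewrite subr_gt0.
move=> y xy; rewrite addrC subrK => /ltW y1.
rewrite mulrAC; apply: le_trans (H x0 xy y1).
rewrite le_eqVlt; apply/orP; left; apply/eqP; congr `|_|.
have sub : (`]x, y]%classic : set R) `<=` `[0, 1]%classic.
  move=> t /=; rewrite !in_itv/= => /andP[xt ty].
  by rewrite (le_trans (ltW x0) (ltW xt)) (le_trans ty y1).
rewrite -Rintegral_itv_bndo_bndc; last first.
  apply: intgS IfT => //.
transitivity (\int[mu]_(t in `]x, y[) p t).
  apply: eq_Rintegral => t /[!inE] txy; rewrite /f patchE mem_set//.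
  by apply: sub; move: txy; rewrite /= !in_itv/= => /andP[-> /ltW].
apply/esym/Rint_indic => // t /=; rewrite !in_itv//=.
by move=> /andP[xt ty]; rewrite (le_trans (ltW x0) (ltW xt)) (le_trans (ltW ty) y1).
Qed.

(** On [[t, s]] the function [|p|] is at most [C * P t] almost everywhere, so its integral there is
    at most [P t / 2]. As [P s = 0], that integral is all of [P t]. *)
Let stepP s t : 0 <= t -> t <= s -> s <= 1 -> C * (s - t) <= 2^-1 -> P s = 0 -> P t = 0.
Proof.
move=> t0 ts s1 st Ps; apply/eqP; rewrite eq_le P_ge0 andbT.
have It : intg `[t, 1] (fun x => `|p x|) by exact: intgS (sub1 t0) Iabs.
have sub : (`[t, s]%classic : set R) `<=` `[t, 1]%classic.
  by move=> x /=; rewrite !in_itv/= => /andP[-> /le_trans]; exact.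
have Its : intg `[t, s] (fun x => `|p x|) by exact: intgS sub It.
have E1 : P t - \int[mu]_(x in `[t, s]) `|p x| <= 0.
  rewrite /P Rintegral_itvB ?bnd_simp//.
  rewrite -Ps Rintegral_itv_obnd_cbnd//.
  apply: intgS It => // x /=; rewrite !in_itv/= => /andP[/ltW/(le_trans ts) -> ->].
  by [].
have E2 : \int[mu]_(x in `[t, s]) `|p x| <= P t / 2.
  have mp : measurable_fun `[t, s] (fun x => `|p x|) by exact: intg_measurable.
  (* Truncation turns the almost everywhere bound into one that holds at every point. *)
  have mm : measurable_fun `[t, s] (fun x => Num.min `|p x| (C * P t)).
    exact: measurable_minr.
  have -> : \int[mu]_(x in `[t, s]) `|p x| =
      \int[mu]_(x in `[t, s]) (Num.min `|p x| (C * P t)).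
    apply: ae_eq_Rint => //.
    apply: (@filterS3 _ _ (ae_filter_ringOfSetsType mu) _ _ _ _ _ ae_le_tail
      (ae_neq 0) (ae_neq 1)) => x px x0 x1 /=; rewrite in_itv/= => /andP[tx xs].
    rewrite min_l//; apply: le_trans (px _ _) _.
    - by rewrite lt_neqAle eq_sym x0 (le_trans t0).
    - by rewrite lt_neqAle x1 (le_trans xs).
    - by rewrite ler_wpM2l// P_anti.
  apply: (@le_trans _ _ (\int[mu]_(x in `[t, s]) (cst (C * P t) x))).
    apply: le_Rintegral => //.
    - apply: (intg_le _ mm Its) => // x _; rewrite ger0_norm; first by rewrite ge_min lexx.
      by rewrite le_min normr_ge0 mulr_ge0.
    - apply: (intg_le (f := cst (C * P t)) (g := cst (C * P t))) => //.
        apply: continuous_compact_integrable; first exact: segment_compact.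
        by apply: within_contT; exact: cst_continuous.
      by move=> x _ /=; rewrite ger0_norm// mulr_ge0.
    - by move=> x _; rewrite /= ge_min lexx orbT.
  have muE : fine (mu (`[t, s]%classic : set R)) = s - t.
    rewrite lebesgue_measure_itv/= lte_fin; have [//|st'] := ltP t s.
    by apply/eqP; rewrite eq_sym subr_eq0 eq_le st' ts.
  rewrite Rintegral_cst//; have -> := muE.
  by rewrite mulrAC mulrC ler_wpM2l.
lra.
Qed.

Lemma ae_eq0 : {ae mu, forall x, x \in `[0, 1] -> p x = 0}.
Proof.
(* The step length must satisfy [C * del <= 1 / 2]; [C + 1] covers [C = 0]. Steps to the left from
   1, cut off at 0, reach 0 after finitely many. *)
pose del := (2 * (C + 1))^-1.
have C1 : 0 < C + 1 by rewrite ltr_wpDl.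
have del0 : 0 < del by rewrite invr_gt0 mulr_gt0.
have Cdel : C * del <= 2^-1.
  by rewrite /del invfM mulrCA ler_piMr// ler_pdivrMr// mul1r lerDl.
clearbody del.
have P1 : P 1 = 0 by rewrite /P set_itv1 Rintegral_set1.
have Pk k : P (Num.max 0 (1 - k%:R * del)) = 0.
  elim: k => [|k IHk]; first by rewrite mul0r subr0 max_r.
  have m0 : 0 <= k%:R * del by rewrite mulr_ge0// ltW.
  apply: stepP IHk.
  - by rewrite le_max lexx.
  - rewrite ge_max le_max lexx/= le_max -natr1 mulrDl mul1r.
    by apply/orP; right; lra.
  - by rewrite ge_max ler01 /=; lra.
  - apply: le_trans Cdel; rewrite ler_wpM2l// -natr1 mulrDl mul1r.
    have [h1|/ltW h1] := leP 0 (1 - k%:R * del);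
      have [h2|/ltW h2] := leP 0 (1 - (k%:R * del + del));
      rewrite ?(max_r h1) ?(max_l h1) ?(max_r h2) ?(max_l h2); lra.
have [k kdel] : exists k : nat, 1 <= k%:R * del.
  exists (Num.bound del^-1); rewrite -ler_pdivrMr// mul1r ltW//.
  by apply: archi_boundP; rewrite invr_ge0 ltW.
have P0 : P 0 = 0 by have := Pk k; rewrite max_l//; lra.
have mp : measurable_fun `[(0 : R), 1] p by exact: intg_measurable.
have : (\int[mu]_(x in `[0%R, 1%R]) `|(EFin \o p) x| = 0)%E.
  have <- : (P 0)%:E = 0%E by rewrite P0.
  rewrite /P /Rintegral fineK//.
  exact: integrable_fin_num Iabs.
move/(ae_eq_integral_abs mu (measurable_itv _)).
have mp' : measurable_fun `[(0 : R), 1] (EFin \o p) by exact/measurable_EFinP.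
move=> /(_ mp'); apply: (@filterS _ _ (ae_filter_ringOfSetsType mu)) => x px x01.
by have := px x01 => -[].
Qed.

End Vanishing.

(** * Green's formula and selection of times *)

Section Pde.
Context {R : realType}.
Local Notation mu := (@lebesgue_measure R).
Local Notation mu2 := (mu \x mu)%E.
Local Notation intg D f := (mu.-integrable D (EFin \o f)).
Implicit Types (f g : R -> R) (x y s t : R).

Lemma ae_exists (P : R -> Prop) (c d : R) : {ae mu, forall x, P x} -> c < d ->
  exists x, [/\ c < x, x < d & P x].
Proof.
move=> [N [mN N0 PN]] cd; apply: contrapT => nP.
have sub : (`]c, d[%classic : set R) `<=` N.
  move=> x /=; rewrite in_itv/= => /andP[cx xd]; apply: PN => Px.
  by apply: nP; exists x.
have : (mu (`]c, d[%classic : set R) <= mu N)%E by apply: le_measure; rewrite ?inE.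
rewrite N0 lebesgue_measure_itv/= lte_fin cd -EFinD lee_fin subr_le0.
by rewrite leNgt cd.
Qed.

(** Identifies the flux, given as a limit of difference quotients, with the value at 1 of the
    continuous derivative that appears in Green's formula. *)
Lemma left_derivative (f g : R -> R) : ac_deriv 0 1 f g ->
  {within `[0, 1], continuous g} ->
  ((f x - f 1) / (x - 1)) @[x --> (1 : R)^'-] --> g 1.
Proof.
move=> acf cg; have [_ _ gl] := (continuous_within_itvP g ltr01).1 cg.
apply/cvgrPdist_le => e e0.
have /cvgrPdist_le/(_ e e0) := gl.
case=> r /= r0 Hr; near=> x.
have x0 : 0 < x by near: x; apply: nbhs_left_gt.
have x1 : x < 1 by near: x; exact: nbhs_left_lt.
have xr : 1 - r < x by near: x; apply: nbhs_left_gt; rewrite ltrBlDr ltrDl.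
have [Ig fE] := acf.
have sub : (`[x, 1]%classic : set R) `<=` `[0, 1]%classic.
  by move=> y /=; rewrite !in_itv/= => /andP[/(le_trans (ltW x0)) -> ->].
have Igx : intg `[x, 1] g by exact: intgS Ig.
have E : f 1 - f x = \int[mu]_(y in `[x, 1]) g y.
  have := fE 1; rewrite in_itv/= lexx ler01 => /(_ isT) ->.
  have := fE x; rewrite in_itv/= !ltW// => /(_ isT) ->.
  rewrite opprD addrACA subrr add0r Rintegral_itvB ?bnd_simp ?(ltW x0) ?(ltW x1)//.
  by rewrite Rintegral_itv_obnd_cbnd//; apply: intgS Igx => // y /=;
    rewrite !in_itv/= => /andP[/ltW -> ->].
have muE (k : R) : \int[mu]_(y in `[x, 1]) (cst k y) = k * (1 - x).
  rewrite Rintegral_cst//.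
  have -> : fine (mu (`[x, 1]%classic : set R)) = 1 - x.
    by rewrite lebesgue_measure_itv/= lte_fin x1.
  by [].
have Ic (k : R) : intg `[x, 1] (cst k).
  apply: continuous_compact_integrable; first exact: segment_compact.
  by apply: within_contT; exact: cst_continuous.
have -> : g 1 - (f x - f 1) / (x - 1) =
    (\int[mu]_(y in `[x, 1]) (cst (g 1) y - g y)) / (1 - x).
  rewrite RintegralB// muE -E; field.
  by rewrite !subr_eq0 (lt_eqF x1) (gt_eqF x1).
have p0 : 0 < 1 - x by rewrite subr_gt0.
rewrite normrM normfV (gtr0_norm p0) ler_pdivrMr// -muE.
apply: norm_Rint_le => //; first exact: intgB.
move=> y /=; rewrite in_itv/= => /andP[xy y1].
move: y1; rewrite le_eqVlt => /predU1P[->|y1]; first by rewrite subrr normr0 ltW.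
apply: Hr => //=; rewrite gtr0_norm ?subr_gt0//.
by rewrite ltrBlDr -ltrBlDl (lt_le_trans xr).
Unshelve. all: by end_near. Qed.

(** The integrand is the derivative of [U1 * f - U * f1], which vanishes at 0. *)
Lemma ac_green (q U U1 U2 f f1 : R -> R) (l : R) : intg `[0, 1] q ->
  ac_deriv 0 1 U U1 -> ac_deriv 0 1 U1 U2 ->
  ac_deriv 0 1 f f1 -> ac_deriv 0 1 f1 (fun x => (q x + l) * f x) ->
  f 0 = 0 -> U 0 = 0 ->
  intg `[0, 1] (fun x => f x * (U2 x - q x * U x - l * U x)) /\
  \int[mu]_(x in `[0, 1]) (f x * (U2 x - q x * U x - l * U x)) =
  U1 1 * f 1 - U 1 * f1 1.
Proof.
move=> Iq acU acU1 acf acf1 f0 U0.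
have [I3 E3] := acD (acM acU1 acf) (acZ (-1) (acM acU acf1)).
have E x : (U2 x * f x + U1 x * f1 x +
    -1 * (U1 x * f1 x + U x * ((q x + l) * f x))) =
    f x * (U2 x - q x * U x - l * U x) by ring.
split; first by apply: intg_ext I3 => // x _; exact: E.
have := E3 1; rewrite in_itv/= lexx ler01 => /(_ isT).
rewrite f0 U0 mulr0 mul0r mulr0 addr0 add0r => E4.
transitivity (U1 1 * f 1 + -1 * (U 1 * f1 1)); last by ring.
by rewrite E4; apply: eq_Rintegral => x _; rewrite E.
Qed.

(** An integrable [M] need not tend to 0 at infinity. But if no such [t] existed, [|M| >= e] would
    hold almost everywhere beyond [c], and the integral over []c, c + k + 1]] would exceed any
    bound. *)
Lemma ae_small_value (M : R -> R) (P : R -> Prop) (c e : R) : intg `]0, +oo[ M ->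
  {ae mu, forall t, P t} -> 0 <= c -> 0 < e ->
  exists t, [/\ c < t, P t & `|M t| < e].
Proof.
move=> IM aeP c0 e0; apply: contrapT => nH.
have IM1 : intg `]0, +oo[ (fun t => `|M t|) by exact: integrable_norm.
pose K := \int[mu]_(t in `]0, +oo[) `|M t|.
have bd k : e * k.+1%:R <= K.
  have sub : (`]c, (c + k.+1%:R)]%classic : set R) `<=` `]0, +oo[%classic.
    by move=> t /=; rewrite !in_itv/= andbT => /andP[/(le_lt_trans c0)].
  have Ik : intg `]c, (c + k.+1%:R)] (fun t => `|M t|) by exact: intgS IM1.
  have mm : measurable_fun (`]c, (c + k.+1%:R)]%classic : set R)
      (fun t => Num.min `|M t| e).
    by apply: measurable_minr => //; exact: intg_measurable.
  have Im : intg `]c, (c + k.+1%:R)] (fun t => Num.min `|M t| e).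
    apply: (intg_le _ mm Ik) => // t _; rewrite ger0_norm ?ge_min ?lexx//.
    by rewrite le_min normr_ge0 ltW.
  apply: (@le_trans _ _ (\int[mu]_(t in `]c, (c + k.+1%:R)]) `|M t|)); last first.
    by apply: Rint_le_subset.
  apply: (@le_trans _ _ (\int[mu]_(t in `]c, (c + k.+1%:R)]) Num.min `|M t| e)); last first.
    by apply: le_Rintegral => // t _; rewrite ge_min lexx.
  rewrite (@ae_eq_Rint _ _ _ (cst e))//; last first.
    apply: (@filterS _ _ (ae_filter_ringOfSetsType mu) _ _ _ aeP) => t Pt /=.
    rewrite in_itv/= => /andP[ct _]; rewrite min_r// leNgt; apply/negP => Mt.
    by apply: nH; exists t.
  rewrite Rintegral_cst//.
  have -> : fine (mu (`]c, (c + k.+1%:R)]%classic : set R)) = k.+1%:R.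
    by rewrite lebesgue_measure_itv/= lte_fin ltrDl ltr0n/= addrC addKr.
  by [].
have K0 : 0 <= K / e by rewrite divr_ge0 ?(ltW e0)// Rintegral_ge0.
have := archi_boundP K0; set k := Num.bound _ => Kk.
have := bd k; rewrite -ler_pdivlMl// mulrC leNgt => /negP; apply.
by rewrite (lt_trans Kk)// ltr_nat.
Qed.

End Pde.

(** * The Laplace transform of the tested heat equation *)

Section TransformIdentity.
Context {R : realType}.
Local Notation mu := (@lebesgue_measure R).
Local Notation mu2 := (mu \x mu)%E.
Local Notation intg D f := (mu.-integrable D (EFin \o f)).
Variables (q a b f f1 : R -> R) (u : R -> R -> R) (l : R).
Hypotheses (Iq : intg `[0, 1] q) (l0 : 0 <= l).
Hypotheses (sol : heat_solution q a u) (flux : boundary_flux u b).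
Hypothesis Iu : mu2.-integrable (`[0, 1] `*` `]0, +oo[)
  (fun z : R * R => (expR (- (l * z.2)) * u z.1 z.2)%:E).
Hypotheses (Ia : intg `]0, +oo[ (fun t => expR (- (l * t)) * a t)).
Hypotheses (Ib : intg `]0, +oo[ (fun t => expR (- (l * t)) * b t)).
Hypotheses (acf : ac_deriv 0 1 f f1)
  (acf1 : ac_deriv 0 1 f1 (fun x => (q x + l) * f x)) (f0 : f 0 = 0).

(** [N] is the time derivative of [M] in integrated form. As [M] is small at suitable times near 0
    and near infinity, the integral of [N] vanishes. *)
Let M t := \int[mu]_(x in `[0, 1]) (f x * (expR (- (l * t)) * u x t)).
Let N t := expR (- (l * t)) * b t * f 1 - expR (- (l * t)) * a t * f1 1.
(** Continuity of [f] is known on [0, 1] only; extended by zero, it is measurable and bounded on the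
    line and can be composed with a projection of the product space. *)
Let F := f \_ `[0, 1].

Let cf : {within `[0, 1], continuous f}. Proof. exact: ac_cont acf. Qed.

Let mF : measurable_fun setT F.
Proof.
have mI : measurable (`[0, 1]%classic : set (measurableTypeR R)) by [].
by apply/(measurable_restrictT _ mI); exact: itv_cont_measurable.
Qed.

Let Fb : exists2 K : R, 0 <= K & forall x, `|F x| <= K.
Proof.
have [K K0 fK] := itv_cont_bounded cf; exists K => // x; rewrite /F patchE.
by case: ifPn => [/[!inE]|_]; [exact: fK|rewrite normr0].
Qed.

Let IuF : mu2.-integrable (`[0, 1] `*` `]0, +oo[)
  (fun z : R * R => (f z.1 * (expR (- (l * z.2)) * u z.1 z.2))%:E).
Proof.
have [K K0 FK] := Fb.
have mAB : measurable ((`[0, 1]%classic : set (measurableTypeR R)) `*`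
   (`]0, +oo[%classic : set (measurableTypeR R))) by exact: measurableX.
have mh : measurable_fun ((`[0, 1]%classic : set (measurableTypeR R)) `*`
   (`]0, +oo[%classic : set (measurableTypeR R))) (F \o fst).
  by apply: measurable_funTS; exact: measurableT_comp.
have := integrableMr mAB mh _ Iu.
have bF : [bounded (F \o fst) x | x in (`[0, 1]%classic : set (measurableTypeR R)) `*`
   (`]0, +oo[%classic : set (measurableTypeR R))].
  exists K; split; first exact: num_real.
  by move=> k Kk z _ /=; exact: le_trans (FK _) (ltW Kk).
move=> /(_ bF); apply: eq_integrable => //.
move=> [x t]; rewrite inE => -[/= x01 _]; rewrite /F patchE mem_set//.
Qed.

Let IM : intg `]0, +oo[ M.
Proof.
have [_ H _ _ _] := Rint_fubini (F := fun x t => f x * (expR (- (l * t)) * u x t))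
  (measurable_itv _) (measurable_itv _) IuF.
exact: H.
Qed.

Let IN : intg `]0, +oo[ N.
Proof. by apply: intgB => //; exact: intgZr. Qed.

Section step.
Variables (ut ux uxx : R -> R -> R).
Hypothesis Hut : forall s T : R, 0 < s -> s < T ->
  mu2.-integrable (`[0, 1] `*` `[s, T]) (fun z : R * R => (ut z.1 z.2)%:E).
Hypothesis Hx : {ae mu, forall x, x \in `[0, 1] ->
  forall s T : R, 0 < s -> s < T -> ac_deriv s T (u x) (ut x)}.

Let good t := [/\ ac_deriv 0 1 (u ^~ t) (ux ^~ t),
    ac_deriv 0 1 (ux ^~ t) (uxx ^~ t),
    {ae mu, forall x, x \in `[0, 1] -> ut x t = uxx x t - q x * u x t},
    u 0 t = 0 /\ u 1 t = a t &
    ((u x t - u 1 t) / (x - 1)) @[x --> (1 : R)^'-] --> b t].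
Hypothesis Hgood : {ae mu, forall t, 0 < t -> good t}.

Let W x t := f x * (expR (- (l * t)) * (ut x t - l * u x t)).

Let IW (s T : R) : 0 < s -> s < T ->
  mu2.-integrable (`[0, 1] `*` `[s, T]) (fun z : R * R => (W z.1 z.2)%:E).
Proof.
move=> s0 sT; have [K K0 FK] := Fb.
pose D := (`[0, 1]%classic : set (measurableTypeR R)) `*`
  (`[s, T]%classic : set (measurableTypeR R)).
have mD : measurable D by exact: measurableX.
pose h (z : measurableTypeR R * measurableTypeR R) := F z.1 * expR (- l * z.2).
have mh : measurable_fun D h.
  apply: measurable_funTS; apply: measurable_funM; first exact: measurableT_comp.
  apply: (measurableT_comp (f := expR)) => //.
  by apply: measurable_funM => //; exact: measurable_snd.
have bh : [bounded h z | z in D].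
  exists K; split; first exact: num_real.
  move=> k Kk [x t] [/= _]; rewrite in_itv/= => /andP[st _].
  rewrite /h normrM; apply: le_trans (ltW Kk); rewrite -[leRHS]mulr1.
  apply: ler_pM => //.
  rewrite ger0_norm ?expR_ge0// -[leRHS](@expR0 R) ler_expR mulNr oppr_le0 mulr_ge0//.
  by rewrite ltW// (lt_le_trans s0).
have J1 := integrableMr mD mh bh (Hut s0 sT).
have J2 : mu2.-integrable D
    (fun z => (f z.1 * (expR (- (l * z.2)) * u z.1 z.2))%:E).
  apply: integrableS IuF => //; first exact: measurableX.
  move=> [x t] [/= x01]; rewrite !in_itv/= => /andP[st _]; split => //=.
  by rewrite ?in_itv/= ?andbT (lt_le_trans s0).
have := integrableB mD J1 (integrableZl mD l J2).
apply: eq_integrable => //.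
move=> [x t]; rewrite inE => -[/= x01 _].
rewrite /= /W /h /F/= patchE mem_set//; congr EFin.
by rewrite mulNr; ring.
Qed.

(** Absolute continuity in [t] holds for almost every [x], the equation in [x] for almost every [t].
    Fubini for [W] joins them: integrating first in [t] gives the increment of [M], first in [x]
    gives [N]. Since [ut] is integrable only away from [t = 0], [s] must be positive. *)
Lemma transform_step (s T : R) : 0 < s -> s < T -> good s -> good T ->
  M T - M s = \int[mu]_(t in `[s, T]) N t.
Proof.
move=> s0 sT [acs _ _ _ _] [acT _ _ _ _].
have [I1 I2 E A1 A2] := Rint_fubini (F := W) (measurable_itv _) (measurable_itv _) (IW s0 sT).
clear Hut IW IuF Iu A1.
pose V1 x := \int[mu]_(t in `[s, T]) W x t.
pose V2 t := \int[mu]_(x in `[0, 1]) W x t.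
have V1E : V1 = fun x => \int[mu]_(t in `[s, T]) W x t := erefl.
have V2E : V2 = fun t => \int[mu]_(x in `[0, 1]) W x t := erefl.
clearbody V1 V2.
rewrite -V1E in I1; rewrite -V2E in I2.
have {}E : \int[mu]_(x in `[0, 1]) V1 x = \int[mu]_(t in `[s, T]) V2 t.
  by rewrite V1E V2E; exact: E.
have J t : ac_deriv 0 1 (u ^~ t) (ux ^~ t) ->
    intg `[0, 1] (fun x => f x * (expR (- (l * t)) * u x t)).
  move=> act; apply: continuous_compact_integrable; first exact: segment_compact.
  apply: within_contM; first exact: cf.
  apply: within_contM; last exact: ac_cont act.
  by apply: within_contT; exact: cst_continuous.
have sub : (`[s, T]%classic : set R) `<=` `]0, +oo[%classic.
  by move=> t /=; rewrite !in_itv/= andbT => /andP[/(lt_le_trans s0)].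
rewrite /M -RintegralB//; [|exact: J..].
transitivity (\int[mu]_(x in `[0, 1]) V1 x).
  apply/esym/ae_eq_Rint => //.
  - exact: intg_measurable.
  - by apply: intg_measurable; apply: intgB => //; exact: J.
  apply: (@filterS _ _ (ae_filter_ringOfSetsType mu) _ _ _ Hx) => x acx x01; rewrite V1E.
  have [I3 E3] := acM (acx x01 _ _ s0 sT) (ac_expR s T (- l)).
  have := E3 T; rewrite in_itv/= lexx ltW// => /(_ isT) ET.
  rewrite -mulrBr -!(mulNr l).
  rewrite [X in f x * (X - _)]mulrC ET (mulrC (expR (- l * s))) addrC addKr.
  rewrite -RintegralZl//; apply: eq_Rintegral => t _.
  by rewrite /W mulNr; ring.
rewrite E; apply: ae_eq_Rint => //.
- exact: intg_measurable.
- by apply: intg_measurable; exact: intgS sub IN.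
apply: (@filterS2 _ _ (ae_filter_ringOfSetsType mu) _ _ _ _ Hgood A2) => t gt It tsT.
have It' := It tsT; rewrite V2E.
have [act acxt aet [u0t u1t] fl] : good t.
  by apply: gt; move: tsT => /sub /=; rewrite in_itv/= andbT.
have Eb : ux 1 t = b t.
  exact: (cvg_unique _ (left_derivative act (ac_cont acxt)) fl).
have [I4 E4] := ac_green Iq act acxt acf acf1 f0 u0t.
transitivity (expR (- (l * t)) *
    \int[mu]_(x in `[0, 1]) (f x * (uxx x t - q x * u x t - l * u x t))).
  rewrite -RintegralZl//; apply: ae_eq_Rint => //.
  - exact: intg_measurable.
  - by apply: intg_measurable; exact: intgZl.
  apply: (@filterS _ _ (ae_filter_ringOfSetsType mu) _ _ _ aet) => x Ex x01.
  by rewrite /W Ex//; ring.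
by rewrite E4 Eb u1t /N; ring.
Qed.

End step.

Let Fabs_bound t : 0 <= t -> intg `[0, 1] (u ^~ t) ->
  forall K, 0 <= K -> (forall x, `|F x| <= K) ->
  `|M t| <= K * \int[mu]_(x in `[0, 1]) `|u x t|.
Proof.
move=> t0 It K K0 FK; have It1 : intg `[0, 1] (fun x => `|u x t|) by exact: integrable_norm.
rewrite -RintegralZl//; apply: norm_Rint_le => //.
- apply: (@intg_ext _ _ (fun x => expR (- (l * t)) * (u x t * f x))) => //.
    by move=> x _; ring.
  by apply: intgZl => //; exact: intgMc.
- exact: intgZl.
- move=> x x01; rewrite normrM; apply: ler_pM => //.
    by have := FK x; rewrite /F patchE mem_set.
  rewrite normrM ler_piMl// ger0_norm ?expR_ge0//.
  by rewrite -[leRHS](@expR0 R) ler_expR oppr_le0 mulr_ge0.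
Qed.

(** Times [sn] tending to 0 come from the initial condition in L^1, times [Tn] tending to infinity
    from the integrability of [M]. Both are taken in the full-measure set of [good] times, and [N]
    is dominated by itself in the limit. *)
Lemma laplace_boundary :
  (\int[mu]_(t in `]0, +oo[) (expR (- (l * t)) * b t)) * f 1 =
  (\int[mu]_(t in `]0, +oo[) (expR (- (l * t)) * a t)) * f1 1.
Proof.
have [ut [ux [uxx [Hut Hx Ht [u00 cv0] Hbc]]]] := sol.
pose good t := [/\ ac_deriv 0 1 (u ^~ t) (ux ^~ t),
    ac_deriv 0 1 (ux ^~ t) (uxx ^~ t),
    {ae mu, forall x, x \in `[0, 1] -> ut x t = uxx x t - q x * u x t},
    u 0 t = 0 /\ u 1 t = a t &
    ((u x t - u 1 t) / (x - 1)) @[x --> (1 : R)^'-] --> b t].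
have Hgood : {ae mu, forall t, 0 < t -> good t}.
  apply: (@filterS3 _ _ (ae_filter_ringOfSetsType mu) _ _ _ _ _ Ht Hbc flux).
  by move=> t H1 H2 H3 t0; have [? ? ?] := H1 t0; split=> //; [exact: H2|exact: H3].
apply/eqP; rewrite -subr_eq0 -!RintegralZr// -RintegralB//; [|exact: intgZr..].
have [K K0 FK] := Fb.
have /choice[sn Hsn] : forall n, exists s, [/\ 0 < s, s < n.+1%:R^-1, good s &
    `|M s| <= n.+1%:R^-1].
  move=> n; have e0 : 0 < n.+1%:R^-1 / (K + 1) :> R.
    by rewrite divr_gt0 ?invr_gt0 ?ltr0n ?ltr_wpDl.
  have cvR : \int[mu]_(x in `[0, 1]) `|u x t - u x 0| @[t --> 0^'+] --> (0 : R).
    exact: fine_cvg cv0.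
  have /cvgr0Pnorm_lt/(_ _ e0)[r /= r0 Hr] := cvR.
  have m0 : 0 < Num.min r n.+1%:R^-1 by rewrite lt_min r0 invr_gt0 ltr0n.
  have [s [s0 sr gs]] := ae_exists Hgood m0.
  have {}gs := gs s0; exists s; move: sr; rewrite lt_min => /andP[sr sn]; split => //.
  have [acs _ _ _ _] := gs.
  have Is : intg `[0, 1] (u ^~ s).
    apply: continuous_compact_integrable; first exact: segment_compact.
    exact: ac_cont acs.
  apply: le_trans (Fabs_bound (ltW s0) Is K0 FK) _.
  have -> : \int[mu]_(x in `[0, 1]) `|u x s| = \int[mu]_(x in `[0, 1]) `|u x s - u x 0|.
    by apply: eq_Rintegral => x /[!inE] x01; rewrite u00// subr0.
  have Hs : `|0 - s| < r by rewrite sub0r normrN gtr0_norm.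
  have /ltW := Hr s Hs s0.
  rewrite ger0_norm; last by apply: Rintegral_ge0.
  move=> H; apply: le_trans (ler_wpM2l K0 H) _.
  rewrite mulrA ler_pdivrMr ?ltr_wpDl// mulrC ler_wpM2l ?invr_ge0//.
  by rewrite lerDl.
have /choice[Tn HTn] : forall n, exists T, [/\ n.+1%:R < T, good T &
    `|M T| <= n.+1%:R^-1].
  move=> n; have e0 : 0 < n.+1%:R^-1 :> R by rewrite invr_gt0 ltr0n.
  have [t [nt gt Mt]] := ae_small_value IM Hgood (ler0n R n.+1) e0.
  exists t; split => //; last exact: ltW.
  by apply: gt; apply: lt_trans nt; rewrite ltr0n.
have sT n : sn n < Tn n.
  have [_ s1 _ _] := Hsn n; have [T1 _ _] := HTn n.
  apply: lt_trans s1 (le_lt_trans _ T1).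
  by apply: (@le_trans _ _ 1); rewrite ?invf_le1 ?ler1n ?ltr0n.
pose G n t := N t * ((sn n <= t)%R && (t <= Tn n)%R)%:R.
have GE n : \int[mu]_(t in `]0, +oo[) G n t = M (Tn n) - M (sn n).
  have [s0 _ gs _] := Hsn n; have [_ gT _] := HTn n.
  rewrite (transform_step Hut Hx Hgood s0 (sT n) gs gT).
  apply: Rint_indic => t /=; rewrite !in_itv/= ?andbT//.
  by move=> /andP[/(lt_le_trans s0)].
have cvG : \int[mu]_(t in `]0, +oo[) G n t @[n --> \oo] --> \int[mu]_(t in `]0, +oo[) N t.
  have mN : measurable_fun (`]0, +oo[%classic : set R) N by exact: intg_measurable IN.
  have [] // := @Rint_cvg R `]0, +oo[ G N (fun t => `|N t|) => //.
  - move=> n; apply: measurable_funM => //.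
    apply: measurable_funTS; apply: measurable_b2R.
    by apply: measurable_and; exact: measurable_fun_ler.
  - exact: integrable_norm IN.
  - move=> t; rewrite /= in_itv/= andbT => t0.
    have ti0 : 0 < t^-1 by rewrite invr_gt0.
    apply: cvg_near_cst; near=> n.
    have [s0 s1 _ _] := Hsn n; have [T1 _ _] := HTn n.
    have h1 : n.+1%:R^-1 < t.
      by near: n; exact: (near_infty_natSinv_lt (PosNum t0)).
    have h2 : n.+1%:R^-1 < t^-1.
      by near: n; exact: (near_infty_natSinv_lt (PosNum ti0)).
    rewrite /G (ltW (lt_trans s1 h1)) (_ : t <= Tn n) ?mulr1//.
    rewrite ltf_pV2 ?posrE ?ltr0n// in h2.
    exact: ltW (lt_trans h2 T1).
  - move=> n t _; rewrite /G; case: (_ && _); rewrite /= ?mulr1 ?mulr0 ?normr0//.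
have bG n : `|\int[mu]_(t in `]0, +oo[) G n t| <= 2 * @harmonic R n.
  have [_ _ _ Ms] := Hsn n; have [_ _ MT] := HTn n.
  rewrite GE (le_trans (ler_normB _ _))// (_ : 2 * _ = @harmonic R n + harmonic n); last by ring.
  by rewrite lerD.
have cvh : 2 * @harmonic R n @[n --> \oo] --> (2 * 0 : R).
  by apply: cvgM; [exact: cvg_cst|exact: cvg_harmonic].
have := norm_le_lim bG cvG cvh.
by rewrite mulr0 normr_le0.
Unshelve. all: by end_near. Qed.

End TransformIdentity.

(** * Laplace transforms vanishing on an interval, and moments *)

Section LaplaceZeros.
Context {R : realType}.
Local Notation mu := (@lebesgue_measure R).
Local Notation intg D f := (mu.-integrable D (EFin \o f)).
Variables (b : R).
Hypothesis b0 : 0 < b.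
Local Notation D := (`]0, b]%classic : set R).

Lemma expR_quadratic (x : R) : 0 <= x -> `|x - (1 - expR (- x))| <= x ^+ 2.
Proof.
move=> x0; have e1 := expR_ge1Dx (- x); rewrite ger0_norm; last by lra.
have : expR (- x) <= (1 + x)^-1.
  by rewrite expRN lef_pV2 ?posrE ?expR_gt0 ?expR_ge1Dx// ltr_wpDr.
have : (1 + x)^-1 <= 1 - x + x ^+ 2.
  by rewrite -div1r ler_pdivrMr ?ltr_wpDr//; nra.
lra.
Qed.

Let intgD_exp (g : R -> R) (l : R) : intg D g -> intg D (fun t => expR (- (l * t)) * g t).
Proof.
move=> Ig; apply: (intgMl (M := expR (`|l| * b))) => // [|t /=].
  apply: (measurableT_comp (f := expR)) => //.
  by apply: measurable_funN; exact: measurable_funM.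
rewrite in_itv/= => /andP[t0 tb]; rewrite ger0_norm ?expR_ge0// ler_expR.
have := ler_norm (- l); rewrite normrN => nl; have := normr_ge0 l; nra.
Qed.

Let intg_mom (g : R -> R) n : intg D g -> intg D (fun t => t ^+ n * g t).
Proof.
move=> Ig; apply: (intgMl (M := b ^+ n)) => // t /=.
rewrite in_itv/= => /andP[t0 tb]; rewrite normrX ger0_norm ?(ltW t0)//.
by apply: lerXn2r; rewrite ?nnegrE// ltW.
Qed.

(** Differentiation under the integral sign along difference quotients, all of which vanish;
    [expR_quadratic] bounds them uniformly. *)
Lemma laplace_deriv (al be : R) (g : R -> R) : 0 <= al -> intg D g ->
  (forall l, al < l -> l < be -> \int[mu]_(t in D) (expR (- (l * t)) * g t) = 0) ->
  forall l, al < l -> l < be -> \int[mu]_(t in D) (expR (- (l * t)) * (t * g t)) = 0.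
Proof.
move=> al0 Ig H l all lbe.
(* Dividing by [n + 2] keeps [l + h n] strictly below [be] already for [n = 0]. *)
pose h n : R := (be - l) / n.+2%:R.
have h0 n : 0 < h n by rewrite divr_gt0 ?subr_gt0.
have hl n : l + h n < be.
  by rewrite -ltrBrDl /h ltr_pdivrMr// ltr_pMr ?subr_gt0// ltr1n.
pose F n t := (h n)^-1 * (expR (- (l * t)) * g t - expR (- ((l + h n) * t)) * g t).
have F0 n : \int[mu]_(t in D) F n t = 0.
  rewrite RintegralZl//; last by apply: intgB => //; exact: intgD_exp.
  rewrite RintegralB//; [|exact: intgD_exp..].
  rewrite H// H ?subrr ?mulr0//.
  by rewrite (lt_trans all)// ltrDl.
have FE n t : F n t = expR (- (l * t)) * ((h n)^-1 * (1 - expR (- (h n * t)))) * g t.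
  rewrite /F (_ : - ((l + h n) * t) = - (l * t) + - (h n * t)); last by ring.
  by rewrite expRD; ring.
have hq n t : 0 <= t -> `|(h n)^-1 * (1 - expR (- (h n * t))) - t| <= h n * t ^+ 2.
  move=> t0; have := expR_quadratic (mulr_ge0 (ltW (h0 n)) t0).
  rewrite -(ler_pM2l (_ : 0 < (h n)^-1)) ?invr_gt0// => Hq.
  have hn : h n != 0 by rewrite gt_eqF.
  rewrite distrC (_ : t - _ = (h n)^-1 * (h n * t - (1 - expR (- (h n * t))))); last by field.
  rewrite normrM ger0_norm ?invr_ge0 ?(ltW (h0 n))//; apply: le_trans Hq _.
  by rewrite le_eqVlt; apply/orP; left; apply/eqP; field.
have cvh : h n @[n --> \oo] --> (0 : R).
  rewrite -(mulr0 (be - l)); apply: cvgM; first exact: cvg_cst.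
  have := @cvg_harmonic R; rewrite -cvg_shiftS; exact.
have [] // := @Rint_cvg R D F (fun t => expR (- (l * t)) * (t * g t))
  (fun t => (b + (be - l) * b ^+ 2) * `|g t|) => //.
- move=> n; apply: intg_measurable; apply: intgZl => //.
  by apply: intgB => //; exact: intgD_exp.
- by apply: intgZl => //; exact: integrable_norm.
- move=> t; rewrite /= in_itv/= => /andP[t0 tb].
  under eq_fun do rewrite FE. rewrite mulrA.
  apply: cvgM; last exact: cvg_cst.
  apply: cvgM; first exact: cvg_cst.
  apply: (norm_squeeze (v := fun n => h n * t ^+ 2)) => [n|]; first exact: hq (ltW t0).
  by rewrite -(mul0r (t ^+ 2)); apply: cvgM => //; exact: cvg_cst.
- move=> n t; rewrite /= in_itv/= => /andP[t0 tb]; rewrite FE normrM ler_wpM2r//.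
  rewrite normrM ger0_norm ?expR_ge0// -[leRHS]mul1r ler_pM ?expR_ge0//.
    rewrite -[leRHS](@expR0 R) ler_expR oppr_le0 mulr_ge0 ?(ltW t0)//.
    by rewrite (le_trans al0)// ltW.
  have := hq n t (ltW t0).
  have hb : h n <= be - l by rewrite /h ler_pdivrMr// ler_peMr ?subr_ge0 ?(ltW lbe)// ler1n.
  have t2 : t ^+ 2 <= b ^+ 2 by apply: lerXn2r; rewrite ?nnegrE// ltW.
  have hh := ler_pM (ltW (h0 n)) (exprn_ge0 2 (ltW t0)) hb t2.
  rewrite !ler_norml => /andP[]; lra.
have -> : (fun n => \int[mu]_(t in D) F n t) = cst 0 by apply/funext => n; exact: F0.
move=> _ cv; apply: (cvg_unique (@Rhausdorff R) cv (cvg_cst 0)).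
Qed.

Lemma laplace_moments (al be l : R) (g : R -> R) n : 0 <= al -> al < l -> l < be ->
  intg D g ->
  (forall l, al < l -> l < be -> \int[mu]_(t in D) (expR (- (l * t)) * g t) = 0) ->
  \int[mu]_(t in D) (t ^+ n * (expR (- (l * t)) * g t)) = 0.
Proof.
move=> al0 all lbe Ig H.
suff K : forall l, al < l -> l < be ->
    \int[mu]_(t in D) (expR (- (l * t)) * (t ^+ n * g t)) = 0.
  by apply: etrans (K _ all lbe); apply: eq_Rintegral => t _; ring.
clear l all lbe; elim: n => [|n IHn] l all lbe.
  by apply: etrans (H _ all lbe); apply: eq_Rintegral => t _; rewrite expr0 mul1r.
apply: etrans (laplace_deriv al0 (intg_mom n Ig) IHn all lbe).
by apply: eq_Rintegral => t _; rewrite exprS; ring.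
Qed.

(** For [b <= s * M] the substitution [r = t / (s M)] maps []0, b]] into [0, 1] and places the jump
    of the threshold, at [r = 1 / M], exactly at [t = s]. Polynomials in [t] thus tend to the
    indicator of [t > s], and the integral of [g] over every tail vanishes. *)
Lemma moments_ae0 (g : R -> R) : intg D g ->
  (forall n, \int[mu]_(t in D) (t ^+ n * g t) = 0) ->
  {ae mu, forall t, 0 < t -> t < b -> g t = 0}.
Proof.
move=> Ig H.
have tail s : 0 < s -> s < b -> \int[mu]_(t in `]s, b]) g t = 0.
  move=> s0 sb.
  have [M bM] : exists M : nat, b <= s * M%:R.
    exists (Num.bound (b / s)); rewrite -ler_pdivrMl// mulrC ltW//.
    by apply: archi_boundP; rewrite divr_ge0 ?ltW.
  have M0 : 0 < s * M%:R by exact: lt_le_trans bM.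
  pose r t := t / (s * M%:R).
  have r01 t : D t -> 0 <= r t <= 1.
    rewrite /= in_itv/= => /andP[t0 tb]; rewrite divr_ge0 ?(ltW t0) ?(ltW M0)//=.
    by rewrite ler_pdivrMr// mul1r (le_trans tb).
  have rM t : M%:R * r t = t / s.
    have Mn : M%:R != 0 :> R by apply: contraTneq M0 => ->; rewrite mulr0 ltxx.
    by rewrite /r; field; rewrite Mn gt_eqF.
  pose F n t := threshold M n (r t) * g t.
  have F0 n : \int[mu]_(t in D) F n t = 0.
    pose c (j : 'I_(M ^ n)) : R := (-1) ^+ j * 'C(M ^ n, j.+1)%:R *
      ((s * M%:R)^-1 ^+ n) ^+ j.+1.
    transitivity (\int[mu]_(t in D) \sum_(j < M ^ n) c j * (t ^+ (n * j.+1) * g t)).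
      apply: eq_Rintegral => t _; rewrite /F thresholdE mulr_suml.
      by apply: eq_bigr => j _; rewrite /c /r exprM !exprMn; ring.
    rewrite Rint_sum//; last by move=> j; apply: intgZl => //; exact: intg_mom.
    rewrite big1// => j _; rewrite RintegralZl ?H ?mulr0//; exact: intg_mom.
  have mth n : measurable_fun setT (fun t => threshold M n (r t)).
    apply: measurable_funB => //; apply: measurable_funX; apply: measurable_funB => //.
    by apply: measurable_funX; exact: measurable_funM.
  have cv : \int[mu]_(t in D) F n t @[n --> \oo] -->
      \int[mu]_(t in D) (g t * (s < t)%R%:R).
    apply: (Rint_cvg_ae (g := fun t => `|g t|)) => //.
    - move=> n; apply: measurable_funM; last exact: intg_measurable.
      exact: measurable_funTS (mth n).
    - apply: measurable_funM; first exact: intg_measurable.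
      by apply: measurable_funTS; apply: measurable_b2R; exact: measurable_fun_ltr.
    - exact: integrable_norm.
    - apply: (@filterS _ _ (ae_filter_ringOfSetsType mu) _ _ _ (ae_neq s)) => t ts Dt.
      have /andP[r0 r1] := r01 _ Dt.
      rewrite mulrC; apply: cvgM; last exact: cvg_cst.
      have [st|st|st] := ltgtP s t; last by rewrite st eqxx in ts.
      + by apply: threshold_cvg1 => //; rewrite rM ltr_pdivlMr// mul1r.
      + by apply: threshold_cvg0 => //; rewrite rM ltr_pdivrMr// mul1r.
    - move=> n t Dt; have /andP[r0 r1] := r01 _ Dt.
      by rewrite normrM ler_piMl// ger0_norm ?threshold_le1 ?threshold_ge0.
  have E : \int[mu]_(t in D) (g t * (s < t)%R%:R) = 0.
    have E0 : (fun n => \int[mu]_(t in D) F n t) = cst 0 by apply/funext => n; exact: F0.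
    rewrite E0 in cv.
    exact: (cvg_unique (@Rhausdorff R) cv (cvg_cst 0)).
  apply: etrans E; apply/esym/Rint_indic => t /=; rewrite !in_itv/=.
    by move=> /andP[st ->]; rewrite (lt_trans s0).
  by move=> /andP[_ ->]; rewrite andbT.
have mD : measurable (D : set (measurableTypeR R)) by [].
have IfT : intg setT (g \_ D).
  by rewrite -restrict_EFin; apply/(integrable_mkcond _ mD).
have := ae_le_of_increments IfT (integrable_locally_restrict mD Ig).
apply: (@filterS _ _ (ae_filter_ringOfSetsType mu)) => x Hx x0 xb.
have fx : (g \_ D) x = g x by rewrite patchE mem_set//= in_itv/= x0 ltW.
apply/eqP; rewrite -normr_le0 -fx; apply: (Hx _ (b - x)); first by rewrite subr_gt0.
move=> y xy; rewrite addrC subrK mul0r => yb.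
have Ixb : intg `]x, b] g.
  by apply: intgS Ig => // t /=; rewrite !in_itv/= => /andP[/(lt_trans x0) -> ->].
have := tail x x0 xb; have := tail y (lt_trans x0 xy) yb => T1 T2.
have E : \int[mu]_(t in `]x, b]) g t - \int[mu]_(t in `]x, y]) g t =
    \int[mu]_(t in `]y, b]) g t.
  by rewrite Rintegral_itvB ?bnd_simp ?(ltW xy) ?(ltW yb).
have -> : \int[mu]_(t in `]x, y]) (g \_ D) t = \int[mu]_(t in `]x, y]) g t.
  apply: eq_Rintegral => t; rewrite inE /= in_itv/= => /andP[xt ty].
  by rewrite patchE mem_set//= in_itv/= (lt_trans x0 xt) (le_trans ty (ltW yb)).
by move: E; rewrite T1 T2 sub0r => /eqP; rewrite oppr_eq0 => /eqP ->; rewrite normr0.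
Qed.

End LaplaceZeros.

(** * Nonvanishing of the transform somewhere in every interval *)

Section Density.
Context {R : realType}.
Local Notation mu := (@lebesgue_measure R).
Local Notation intg D f := (mu.-integrable D (EFin \o f)).

(** If the transform vanished on the whole interval, so would all its derivatives at the midpoint
    [l], which are up to sign the moments of [expR (- (l * t)) * a t]. Compact support reduces these
    to a bounded interval. *)
Lemma laplace_nonzero (a : R -> R) (al be : R) : intg `]0, +oo[ a ->
  compactly_supported a -> ~ {ae mu, forall t, 0 < t -> a t = 0} ->
  0 <= al -> al < be ->
  exists l, [/\ al < l, l < be & \int[mu]_(t in `]0, +oo[) (expR (- (l * t)) * a t) != 0].
Proof.
move=> Ia [T aT] an0 al0 albe; apply: contrapT => nH; apply: an0.
(* Both [0 < b] and [T < b] are needed, and [T] may be negative. *)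
pose b := Num.max T 0 + 1.
have b0 : 0 < b by rewrite /b ltr_wpDl// le_max lexx orbT.
have Tb : T < b by rewrite /b (le_lt_trans (_ : T <= Num.max T 0)) ?ltrDl// le_max lexx.
have sub : (`]0, b]%classic : set R) `<=` `]0, +oo[%classic.
  by move=> t /=; rewrite !in_itv/= andbT => /andP[].
have IaD : intg `]0, b] a by exact: intgS sub Ia.
have Il l : 0 <= l -> intg `]0, +oo[ (fun t => expR (- (l * t)) * a t).
  move=> l0; apply: (intgMl (M := 1)) => // [|t /=].
    apply: (measurableT_comp (f := expR)) => //.
    by apply: measurable_funN; exact: measurable_funM.
  rewrite in_itv/= andbT => t0; rewrite ger0_norm ?expR_ge0//.
  by rewrite -[leRHS](@expR0 R) ler_expR oppr_le0 mulr_ge0// ltW.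
have H l : al < l -> l < be -> \int[mu]_(t in `]0, b]) (expR (- (l * t)) * a t) = 0.
  move=> all lbe; have l0 : 0 <= l by rewrite ltW// (le_lt_trans al0).
  transitivity (\int[mu]_(t in `]0, +oo[) (expR (- (l * t)) * a t)); last first.
    by apply/eqP; apply: contrapT => /negP nz; apply: nH; exists l.
  rewrite -(@Rint_indic _ _ `]0, +oo[ (fun t => t <= b)) //; last first.
    by move=> t /=; rewrite !in_itv/= andbT => ->.
  apply: ae_eq_Rint => //.
  - apply: measurable_funM; first exact: intg_measurable (Il _ l0).
    by apply: measurable_funTS; apply: measurable_b2R; exact: measurable_fun_ler.
  - exact: intg_measurable (Il _ l0).
  apply: (@filterS _ _ (ae_filter_ringOfSetsType mu) _ _ _ aT) => t at0 _.
  have [tb|bt] := leP t b; first by rewrite mulr1.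
  by rewrite (at0 (lt_trans Tb bt)) !mulr0 ?mul0r.
pose l := (al + be) / 2.
have all : al < l by rewrite /l; lra.
have lbe : l < be by rewrite /l; lra.
have Ig : intg `]0, b] (fun t => expR (- (l * t)) * a t).
  by apply: intgS sub (Il _ _) => //; rewrite (le_trans al0)// ltW.
have mom n := laplace_moments b0 n al0 all lbe IaD H.
have := moments_ae0 b0 Ig mom.
apply: (@filterS2 _ _ (ae_filter_ringOfSetsType mu) _ _ _ _ aT) => t at0 gt t0.
have [tb|bt] := ltP t b; last by apply: at0; exact: lt_le_trans bt.
have /eqP := gt t0 tb; rewrite mulf_eq0 gt_eqF ?expR_gt0//= => /eqP.
exact.
Qed.

End Density.

(** * Enlarging the abscissa of a Laplace integral *)

Section Assembly.
Context {R : realType}.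
Local Notation mu := (@lebesgue_measure R).
Local Notation mu2 := (mu \x mu)%E.
Local Notation intg D f := (mu.-integrable D (EFin \o f)).

Lemma laplace_mono (f : R -> R) (s l : R) : s <= l ->
  intg `]0, +oo[ (fun t => expR (- (s * t)) * f t) ->
  intg `]0, +oo[ (fun t => expR (- (l * t)) * f t).
Proof.
move=> sl If; apply: (@intg_ext _ _
    (fun t => expR (- ((l - s) * t)) * (expR (- (s * t)) * f t))) => //.
  by move=> t _; rewrite mulrA -expRD; congr (expR _ * _); ring.
apply: (intgMl (M := 1)) => // [|t /=].
  apply: (measurableT_comp (f := expR)) => //.
  by apply: measurable_funN; exact: measurable_funM.
rewrite in_itv/= andbT => t0; rewrite ger0_norm ?expR_ge0//.
by rewrite -[leRHS](@expR0 R) ler_expR oppr_le0 mulr_ge0 ?subr_ge0// ltW.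
Qed.

Lemma laplace_in_t_mono (u : R -> R -> R) (s l : R) : s <= l ->
  mu2.-integrable (`[0, 1] `*` `]0, +oo[)
    (fun z : R * R => (expR (- (s * z.2)) * u z.1 z.2)%:E) ->
  mu2.-integrable (`[0, 1] `*` `]0, +oo[)
    (fun z : R * R => (expR (- (l * z.2)) * u z.1 z.2)%:E).
Proof.
move=> sl Iu.
pose D := (`[0, 1]%classic : set (measurableTypeR R)) `*`
  (`]0, +oo[%classic : set (measurableTypeR R)).
have mD : measurable D by exact: measurableX.
pose h (z : measurableTypeR R * measurableTypeR R) := expR (- (l - s) * z.2).
have mh : measurable_fun D h.
  apply: measurable_funTS; apply: (measurableT_comp (f := expR)) => //.
  by apply: measurable_funM => //; exact: measurable_snd.
have bh : [bounded h z | z in D].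
  exists 1; split; first exact: num_real.
  move=> k k1 [x t] [/= _]; rewrite in_itv/= andbT => t0.
  apply: le_trans (ltW k1); rewrite ger0_norm ?expR_ge0//.
  rewrite -[leRHS](@expR0 R) ler_expR mulNr oppr_le0 mulr_ge0 ?subr_ge0//.
  exact: ltW.
have := integrableMr mD mh bh Iu; apply: eq_integrable => //.
move=> [x t] _; rewrite /h /= -EFinM; congr EFin.
by rewrite mulrA -expRD; congr (expR _ * _); ring.
Qed.

End Assembly.

Unset Implicit Arguments.

Theorem theorem4p1 (R : realType) (a : R -> R)
  (a_L1 : (@lebesgue_measure R).-integrable `]0, +oo[ (EFin \o a))
  (a_neq0 : ~ {ae (@lebesgue_measure R), forall t, 0 < t -> a t = 0})
  (a_supp : compactly_supported a)
  (q1 q2 : R -> R)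
  (q1_L1 : (@lebesgue_measure R).-integrable `[0, 1] (EFin \o q1))
  (q2_L1 : (@lebesgue_measure R).-integrable `[0, 1] (EFin \o q2))
  (u1 u2 : R -> R -> R)
  (u1_sol : heat_solution q1 a u1) (u2_sol : heat_solution q2 a u2)
  (u1_laplace : laplace_transformable_in_t u1)
  (u2_laplace : laplace_transformable_in_t u2)
  (b : R -> R)
  (b_laplace : laplace_transformable b)
  (u1_flux : boundary_flux u1 b) (u2_flux : boundary_flux u2 b) :
  {ae (@lebesgue_measure R), forall x, x \in `[0, 1] -> q1 x = q2 x}.
Proof.
have [s1 Iu1] := u1_laplace; have [s2 Iu2] := u2_laplace.
have [sb Ib] := b_laplace.
(* One nonnegative abscissa beyond which the transforms of [a], [b], [u1] and [u2] all converge. *)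
pose L := Num.max (Num.max s1 s2) (Num.max sb 0).
have L1 : s1 <= L by rewrite /L !le_max lexx.
have L2 : s2 <= L by rewrite /L !le_max lexx orbT.
have Lb : sb <= L by rewrite /L !le_max lexx !orbT.
have L0 : 0 <= L by rewrite /L !le_max lexx !orbT.
clearbody L.
pose mu := @lebesgue_measure R.
pose A l : R := \int[mu]_(t in `]0, +oo[) (expR (- (l * t)) * a t).
have a_L1' : mu.-integrable `]0, +oo[ (EFin \o (fun t => expR (- (0 * t)) * a t)).
  apply: (@intg_ext _ _ a) => //.
  by move=> t _; rewrite mul0r oppr0 expR0 mul1r.
(* For [z >= Z] the spectral parameter [(z / 2)^2] is at least [(1 + L)^2], hence at least [L]. *)
pose Z := 2 * (1 + L).
have Z0 : 0 <= Z by rewrite /Z; lra.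
have bound_nz z : Z <= z -> large q1 z -> large q2 z -> A ((z / 2) ^+ 2) != 0 ->
    `|jost_product q1 q2 z| <= 16 * z.
  move=> Zz l1 l2 A0; set l := (z / 2) ^+ 2 in A0.
  have Ll : L <= l by rewrite /l; move: Zz; rewrite /Z => Zz; nra.
  have lge0 := le_trans L0 Ll.
  apply: (jost_product_le (B := \int[mu]_(t in `]0, +oo[) (expR (- (l * t)) * b t))
    q1_L1 q2_L1 l1 l2 A0) => f f1 acf acf1 f0.
  - apply: (laplace_boundary q1_L1 lge0 u1_sol u1_flux _ _ _ acf acf1 f0).
    + exact: laplace_in_t_mono (le_trans L1 Ll) Iu1.
    + exact: laplace_mono lge0 a_L1'.
    + exact: laplace_mono (le_trans Lb Ll) Ib.
  - apply: (laplace_boundary q2_L1 lge0 u2_sol u2_flux _ _ _ acf acf1 f0).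
    + exact: laplace_in_t_mono (le_trans L2 Ll) Iu2.
    + exact: laplace_mono lge0 a_L1'.
    + exact: laplace_mono (le_trans Lb Ll) Ib.
have bound z : Z <= z -> large q1 z -> large q2 z -> `|jost_product q1 q2 z| <= 16 * z.
  move=> Zz l1 l2; have z0 := large_gt0 l1.
  (* The zeros of [A] are avoided by approaching [z] from the right, where [Z <= z] and [large]
     persist. [laplace_nonzero] works in [l = (y / 2)^2], whence the square root. *)
  have /choice[zn Hzn] : forall n, exists y : R,
      [/\ z < y, y < z + n.+1%:R^-1 & A ((y / 2) ^+ 2) != 0].
    move=> n; have e0 : 0 < n.+1%:R^-1 :> R by rewrite invr_gt0 ltr0n.
    set e : R := n.+1%:R^-1 in e0 *.
    have zz : (z / 2) ^+ 2 < ((z + e) / 2) ^+ 2 by nra.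
    have [l [lz lze nz]] := laplace_nonzero a_L1 a_supp a_neq0 (sqr_ge0 (z / 2)) zz.
    have l0 : 0 <= l by apply: le_trans (ltW lz); exact: sqr_ge0.
    have sl : Num.sqrt l ^+ 2 = l by rewrite sqr_sqrtr.
    have s0 := sqrtr_ge0 l.
    exists (2 * Num.sqrt l); rewrite mulrC mulfK ?pnatr_eq0// sl; split => //.
    + by rewrite -sl in lz; nra.
    + by rewrite -sl in lze; nra.
  have lzn q n : large q z -> large q (zn n).
    have [zy _ _] := Hzn n; move=> /andP[z2 zq].
    by apply/andP; split; apply: le_trans (ltW zy).
  have czn : zn n @[n --> \oo] --> z.
    apply: (norm_squeeze (v := harmonic)); last exact: cvg_harmonic.
    move=> n; have [zy yz _] := Hzn n; rewrite ger0_norm ?subr_ge0 ?(ltW zy)//.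
    by rewrite /harmonic /= lerBlDl ltW.
  have zn1 n : zn n <= z + 1.
    have [_ yz _] := Hzn n; rewrite (le_trans (ltW yz))// lerD2l.
    by rewrite invf_le1 ?ltr0n// ler1n.
  have cv := jost_product_cvg q1_L1 q2_L1 (fun n => lzn _ n l1) (fun n => lzn _ n l2)
    l1 l2 zn1 czn.
  apply: (norm_le_lim _ cv (w := fun n => 16 * zn n)) => [n|].
    have [zy _ nz] := Hzn n.
    by apply: bound_nz => //; [exact: le_trans Zz (ltW zy)|exact: lzn..].
  by apply: cvgM => //; exact: cvg_cst.
have C0 : 0 <= 2 * expR (2 + 16 * l1norm q1 + 16 * l1norm q2 + Z) *
    (2 * l1norm q1 + 4 * l1norm q2).
  by rewrite !mulr_ge0 ?expR_ge0// addr_ge0// mulr_ge0// l1norm_ge0.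
have := ae_eq0 (intgB (measurable_itv _) q2_L1 q1_L1) C0
  (increment_bound Z0 q1_L1 q2_L1 bound).
apply: (@filterS _ _ (ae_filter_ringOfSetsType mu)) => x qx x01.
by apply/esym/eqP; rewrite -subr_eq0 qx.
Qed.
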